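(* Let $K$ be a UFD of characteristic $p>0$, let $A=K[x_1,\dots,x_n]$, let $m\in\{1,\dots,n\}$, and consider arbitrary polynomials $f_1,\dots,f_m\in A$. Denote $B=K[x_1^p,\dots,x_n^p]$, $R_i=B[f_1,\dots,\widehat{f_i},\dots,f_m]$ for $i\in\{1,\dots,m\}$, and $R_{ij}=B[f_1,\dots,\widehat{f_i},\dots,\widehat{f_j},\dots,f_m]$ for $i\neq j$ (a hat means that the element is omitted). The following conditions are equivalent: (1) $\mathrm{dgcd}(f_1,\dots,f_m)\sim 1$; (2) the polynomials $f_1,\dots,f_m$ form a $p$-basis (over $B$) of the ring of constants of some $K$-derivation of $A$; (3) the polynomial $bf_i+c$ is square-free and $B$-free for every $i\in\{1,\dots,m\}$ and all $b,c\in R_i$ such that $b\neq 0$ and $\gcd(b,c)\sim 1$; and, if $m>1$, then $\gcd(b_1f_i+c_1,\,b_2f_j+c_2)\sim 1$ for every $i,j\in\{1,\dots,m\}$, $i\neq j$, and all $b_1,b_2,c_1,c_2\in R_{ij}$ such that $b_1,b_2\neq 0$, $\gcd(b_1,c_1)\sim 1$ and $\gcd(b_2,c_2)\sim 1$.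
   Context: All gcd's and divisibility relations are taken in the UFD $A=K[x_1,\dots,x_n]$. For $a,b\in A$, $a\sim b$ means that $a$ and $b$ are associated, i.e. $a=bc$ for some invertible $c\in A$. For $j_1,\dots,j_m\in\{1,\dots,n\}$, $\mathrm{jac}^{f_1,\dots,f_m}_{j_1,\dots,j_m}=\det\left[\frac{\partial f_i}{\partial x_{j_l}}\right]_{1\le i,l\le m}$. The differential gcd is $\mathrm{dgcd}(f_1,\dots,f_m)=\gcd\left(\mathrm{jac}^{f_1,\dots,f_m}_{j_1,\dots,j_m};\ j_1,\dots,j_m\in\{1,\dots,n\}\right)$, with $\mathrm{dgcd}(f_1,\dots,f_m)=0$ if all these determinants are zero. The ring of constants of a derivation $d$ of $A$ is its kernel $A^d=\{a\in A: d(a)=0\}$. A $K$-derivation is a $K$-linear derivation $d:A\to A$. If $R$ is a subring of $A$ containing $B$, then $f_1,\dots,f_m$ form a $p$-basis of $R$ over $B$ if the elements $f_1^{\alpha_1}\cdots f_m^{\alpha_m}$ with $0\le\alpha_1,\dots,\alpha_m<p$ form a basis of $R$ as a $B$-module. An element $a\in A$ is square-free if it is not divisible by the square of any noninvertible element of $A$; it is $B$-free if it is not divisible (in $A$) by any noninvertible element of $B$. *)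

(* Defs.v *)
From HB Require Import structures.
From mathcomp Require Import all_boot all_order all_algebra.
From mathcomp Require Export mpoly.

Set Implicit Arguments.
Unset Strict Implicit.
Unset Printing Implicit Defensive.

Import GRing.Theory.
Local Open Scope ring_scope.

(* Subsets of a ring are predicates [A -> Prop], since membership in the rings
   considered here is not given by a boolean test. *)

Section Divisibility.
Variable A : idomainType.
Implicit Types (a b c d g x y : A) (S B : A -> Prop).

Definition divides a b : Prop := exists c, b = c * a.

Definition associated a b : Prop :=
  exists c, c \is a GRing.unit /\ a = b * c.

Definition irreducible_elt a : Prop :=
  [/\ a != 0, a \isn't a GRing.unit
    & forall b c, a = b * c -> b \is a GRing.unit \/ c \is a GRing.unit].

Definition is_ufd : Prop :=
  (forall a, a != 0 -> a \isn't a GRing.unit ->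
     exists s : seq A,
       (forall x, x \in s -> irreducible_elt x) /\ a = \prod_(x <- s) x)
  /\
  (forall s t : seq A,
     (forall x, x \in s -> irreducible_elt x) ->
     (forall x, x \in t -> irreducible_elt x) ->
     \prod_(x <- s) x = \prod_(x <- t) x ->
     exists t' : seq A,
       [/\ perm_eq t t', size s = size t'
         & forall i, (i < size s)%N -> associated s`_i t'`_i]).

(* A gcd is determined only up to association, so it is a relation; 0 is the
   gcd of S exactly when all elements of S are zero. *)
Definition is_gcd S g : Prop :=
  (forall a, S a -> divides g a) /\
  (forall d, (forall a, S a -> divides d a) -> divides d g).

(* gcd(a, b) ~ 1 *)
Definition gcd_sim1 a b : Prop :=
  exists g, is_gcd (fun x => x = a \/ x = b) g /\ associated g 1.

Definition square_free a : Prop :=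
  forall b, b \isn't a GRing.unit -> ~ divides (b ^+ 2) a.

(* In the intended case B = K[x_1^p, ..., x_n^p], an element of B is invertible
   in B if and only if it is invertible in A. *)
Definition free_of B a : Prop :=
  forall b, B b -> b \isn't a GRing.unit -> ~ divides b a.

End Divisibility.

(* The subring B[S] of A generated by B and S. *)
Inductive adjoin (A : nzRingType) (B S : A -> Prop) : A -> Prop :=
| adjoin_base a of B a : adjoin B S a
| adjoin_gen a of S a : adjoin B S a
| adjoin1 : adjoin B S 1
| adjoinB a b of adjoin B S a & adjoin B S b : adjoin B S (a - b)
| adjoinM a b of adjoin B S a & adjoin B S b : adjoin B S (a * b).

(* The family v is a basis of the B-submodule R of A. *)
Definition is_module_basis (A : nzRingType) (B R : A -> Prop) (I : finType)
    (v : I -> A) : Prop :=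
  [/\ forall i, R (v i),
      forall a, R a ->
        exists c : I -> A, (forall i, B (c i)) /\ a = \sum_i c i * v i
    & forall c : I -> A, (forall i, B (c i)) ->
        \sum_i c i * v i = 0 -> forall i, c i = 0].

(* f is a p-basis of R over B, where R is a subring of A containing B. *)
Definition is_p_basis (A : comNzRingType) (p m : nat) (B R : A -> Prop)
    (f : 'I_m -> A) : Prop :=
  is_module_basis B R
    (fun alpha : {ffun 'I_m -> 'I_p} => \prod_(i < m) f i ^+ alpha i).

Section Polynomials.
Variables (K : idomainType) (n : nat).
Local Notation A := {mpoly K[n]}.

Definition is_derivation (d : {linear A -> A}) : Prop :=
  forall a b : A, d (a * b) = d a * b + a * d b.

Definition constants (d : {linear A -> A}) : A -> Prop := fun a => d a = 0.

(* K[x_1^p, ..., x_n^p] *)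
Definition ppow_ring (p : nat) : A -> Prop :=
  adjoin (fun a => exists c : K, a = c%:MP) (fun a => exists i, a = 'X_i ^+ p).

Definition jac (m : nat) (f : 'I_m -> A) (j : 'I_m -> 'I_n) : A :=
  \det (\matrix_(i < m, l < m) mderiv (j l) (f i)).

Definition is_dgcd (m : nat) (f : 'I_m -> A) (g : A) : Prop :=
  is_gcd (fun a => exists j : 'I_m -> 'I_n, a = jac f j) g.

(* B[f_1, ..., f_i omitted, ..., f_m], with B = K[x_1^p, ..., x_n^p] *)
Definition R1 (p m : nat) (f : 'I_m -> A) (i : 'I_m) : A -> Prop :=
  adjoin (ppow_ring p) (fun a => exists k : 'I_m, k != i /\ a = f k).

(* The same with both f_i and f_j omitted. *)
Definition R2 (p m : nat) (f : 'I_m -> A) (i j : 'I_m) : A -> Prop :=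
  adjoin (ppow_ring p) (fun a => exists k : 'I_m, [/\ k != i, k != j & a = f k]).

End Polynomials.

(* Main.v *)
(** Write B = K[x_1^p, ..., x_n^p]; it consists of the polynomials all of whose
    partial derivatives vanish, and A is factorial by Gauss's lemma.  The three
    conditions are proved equivalent cyclically.

    (1) => (2): if N in B divides a reduced polynomial q in f with coefficients in B,
    differentiating shows that N divides (dq/df_i) jac for every Jacobian jac, hence
    divides dq/df_i, and by induction all coefficients of q; so the reduced monomials
    in f are independent and B[f] contains every element of A in its fraction field.
    That field is the field of constants of a derivation acting diagonally on suitable
    variables, with eigenvalues generic enough for 0 to occur only on it.

    (2) => (3): if g^2 divides W = b f_i + c, then W^(p-1) / g^p is a constant, hence a
    polynomial in f, and its top coefficient shows that g divides b.  The argument for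
    pairs uses W_1^(p-1) W_2 / g^p.

    (3) => (1): let g be a prime dividing all Jacobians.  In the fraction field of A/g
    some f_i lies in the field generated by the others over the image of B; otherwise
    derivations dual to the f_i would show that the Jacobian matrix has full rank mod g.
    Thus g divides some W = b f_i + c, so g is not in B and dg is nonzero mod g.  If some
    other f_j also depends on the remaining ones, g divides two such forms.  Otherwise
    dW is mod g a nonzero multiple of dg, because g^2 does not divide W, and dg is
    independent of the df_j, so the Jacobian matrix has full rank after all. *)

From HB Require Import structures.
Require Import Defs.
From mathcomp Require Import all_boot all_order all_algebra.
From mathcomp Require Import ring_quotient zify ring.
From Stdlib Require Import Classical ClassicalEpsilon.

Set Implicit Arguments.
Unset Strict Implicit.
Unset Printing Implicit Defensive.

Import GRing.Theory.
Local Open Scope ring_scope.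

(** * Divisibility and prime quotients *)

Section Divides.
Variable A : idomainType.
Implicit Types (a b c d q : A) (s : seq A).

Lemma divides_refl a : divides a a.
Proof. by exists 1; rewrite mul1r. Qed.

Lemma divides0 a : divides a 0.
Proof. by exists 0; rewrite mul0r. Qed.

Lemma divides_trans b a c : divides a b -> divides b c -> divides a c.
Proof. by case=> u -> [v ->]; exists (v * u); rewrite mulrA. Qed.

Lemma divides_mull a b c : divides a b -> divides a (c * b).
Proof. by case=> u ->; exists (c * u); rewrite mulrA. Qed.

Lemma divides_mulr a b c : divides a b -> divides a (b * c).
Proof. by rewrite mulrC; apply: divides_mull. Qed.

Lemma dividesD a b c : divides a b -> divides a c -> divides a (b + c).
Proof. by case=> u -> [v ->]; exists (u + v); rewrite mulrDl. Qed.

Lemma dividesN a b : divides a b -> divides a (- b).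
Proof. by case=> u ->; exists (- u); rewrite mulNr. Qed.

Lemma dividesB a b c : divides a b -> divides a c -> divides a (b - c).
Proof. by move=> ab /dividesN; apply: dividesD. Qed.

Lemma divides_sum a (I : Type) (r : seq I) (P : pred I) (F : I -> A) :
  (forall i, P i -> divides a (F i)) -> divides a (\sum_(i <- r | P i) F i).
Proof.
by move=> aF; apply: big_ind => //; [apply: divides0 | move=> *; apply: dividesD].
Qed.

Lemma dividesDr a b c : divides a b -> divides a (b + c) -> divides a c.
Proof.
by move=> ab abc; rewrite -[c](addKr b) addrC; apply: dividesB.
Qed.

Lemma divides_unit u a : u \is a GRing.unit -> divides u a.
Proof. by move=> Uu; exists (a * u^-1); rewrite mulrVK. Qed.

Lemma divides_unitE a u : u \is a GRing.unit -> divides a u ->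
  a \is a GRing.unit.
Proof. by move=> Uu [c cE]; move: Uu; rewrite cE unitrM => /andP[]. Qed.

Lemma divides_mul2l c a b : c != 0 -> divides (c * a) (c * b) -> divides a b.
Proof.
by move=> c0 [u]; rewrite mulrCA => /(mulfI c0) ->; exists u.
Qed.

(** The value q = 0 is allowed, so that one quotient construction yields both residue fields and the
    fraction field of A. *)
Definition prime_ideal q : Prop :=
  q \isn't a GRing.unit /\
  forall a b, divides q (a * b) -> divides q a \/ divides q b.

Definition prime_elt q : Prop := q != 0 /\ prime_ideal q.

Lemma prime_ideal0 : prime_ideal 0.
Proof.
split; first by rewrite unitr0.
by move=> a b [c /eqP]; rewrite mulr0 mulf_eq0 => /orP[/eqP->|/eqP->];
  [left|right]; apply: divides0.
Qed.

Lemma prime_ideal_exp q a n : prime_ideal q -> divides q (a ^+ n) ->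
  divides q a.
Proof.
move=> [Uq qP]; elim: n => [|n IHn].
  by rewrite expr0 => /(divides_unitE (unitr1 _)); rewrite (negPf Uq).
by rewrite exprS => /qP[].
Qed.

Lemma prime_prod q s : prime_ideal q -> divides q (\prod_(x <- s) x) ->
  exists2 x, x \in s & divides q x.
Proof.
move=> [Uq qP]; elim: s => [|x s IHs].
  by rewrite big_nil => /(divides_unitE (unitr1 _)); rewrite (negPf Uq).
rewrite big_cons => /qP[qx | /IHs[y ys qy]]; first by exists x; rewrite ?mem_head.
by exists y; rewrite // inE ys orbT.
Qed.

Lemma unit_mul1 a b : a * b = 1 -> a \is a GRing.unit.
Proof. by move=> ab1; apply/unitrP; exists b; rewrite mulrC ab1. Qed.

Lemma prime_irreducible q a b : prime_elt q -> q = a * b ->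
  a \is a GRing.unit \/ b \is a GRing.unit.
Proof.
move=> [q0 [Uq qP]] qE.
have := divides_refl q; rewrite {2}qE => /qP[][c cE].
- right; apply: (@unit_mul1 _ c); apply: (mulfI q0).
  by rewrite mulr1 [in RHS]qE cE; ring.
- left; apply: (@unit_mul1 _ c); apply: (mulfI q0).
  by rewrite mulr1 [in RHS]qE cE; ring.
Qed.

End Divides.

(** Factorization into primes rather than irreducibles: uniqueness is implicit in primality, and
    units get the empty product. *)
Definition factorial_dom (A : idomainType) : Prop :=
  forall a : A, a != 0 -> exists (u : A) (s : seq A),
    [/\ u \is a GRing.unit, forall x, x \in s -> prime_elt x
      & a = u * \prod_(x <- s) x].

Section Factorial.
Variable A : idomainType.
Hypothesis fA : factorial_dom A.
Implicit Types (a b c d q : A) (s : seq A).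

Lemma prime_factor a : a != 0 -> a \isn't a GRing.unit ->
  exists2 q, prime_elt q & divides q a.
Proof.
move=> a0 Ua; have [u [[|q s] [Uu sP aE]]] := fA a0.
  by rewrite aE big_nil mulr1 Uu in Ua.
exists q; first by apply: sP; rewrite mem_head.
by rewrite aE big_cons; apply/divides_mull/divides_mulr/divides_refl.
Qed.

(* The junk case a = 0 is covered as soon as A has a prime element. *)
Lemma prime_factor0 a : (exists q, prime_elt q) -> a \isn't a GRing.unit ->
  exists2 q, prime_elt q & divides q a.
Proof.
move=> [q qP] Ua; have [a0|] := eqVneq a 0; last by move/prime_factor; apply.
by exists q; rewrite // a0; apply: divides0.
Qed.

(** The prime factors of N are removed one by one: a factor q fails to divide some a in S, hence
    divides x, and is cancelled from both N and x. *)
Lemma divides_coprime (S : A -> Prop) N x :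
    (forall q, prime_elt q -> exists2 a, S a & ~ divides q a) ->
    (forall a, S a -> divides N (x * a)) -> (exists2 a, S a & a != 0) ->
  divides N x.
Proof.
move=> Sq Nx [a0 Sa0 a0n0]; have [N0|/fA[u [s [Uu]]]] := eqVneq N 0.
  case: (Nx _ Sa0) => c /eqP; rewrite N0 mulr0 mulf_eq0 (negPf a0n0) orbF.
  by move/eqP->; apply: divides0.
elim: s u x N Uu Nx => [|q s IHs] u x N Uu Nx sP NE.
  by apply: divides_unit; rewrite NE big_nil mulr1.
have qP : prime_elt q by apply: sP; rewrite mem_head.
have qN : divides q N by rewrite NE big_cons mulrCA; apply/divides_mulr/divides_refl.
have [b Sb qb] := Sq q qP.
have [[y yE]|//] := (qP.2.2 _ _ (divides_trans qN (Nx b Sb))).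
have NE' : N = q * (u * \prod_(x <- s) x) by rewrite NE big_cons; ring.
have [c cE] : divides (u * \prod_(x <- s) x) y.
  apply: (IHs u y _ Uu) => // [a Sa|z zs]; last by apply: sP; rewrite inE zs orbT.
  apply: (divides_mul2l qP.1); rewrite -NE'.
  by have := Nx a Sa; rewrite yE mulrAC [y * a * q]mulrC.
by exists c; rewrite yE cE NE'; ring.
Qed.

End Factorial.

(** If a b = c q, unique factorization matches q, up to a unit, with an irreducible factor of a or
    of b. *)
Lemma irreducible_prime (K : idomainType) : is_ufd K ->
  forall q : K, irreducible_elt q -> prime_elt q.
Proof.
move=> [fact uniq] q qI; have [q0 Uq qP] := qI; split=> //; split=> // a b [c].
have [-> _|a0] := eqVneq a 0; first by left; apply: divides0.
have [-> _|b0] := eqVneq b 0; first by right; apply: divides0.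
have [Ua abE|Ua] := boolP (a \is a GRing.unit).
  by right; exists (a^-1 * c); rewrite -mulrA -abE mulKr.
have [Ub abE|Ub] := boolP (b \is a GRing.unit).
  by left; exists (c * b^-1); rewrite mulrAC -abE mulrK.
have [s [sI aE]] := fact a a0 Ua; have [t [tI bE]] := fact b b0 Ub.
have stI x : x \in s ++ t -> irreducible_elt x.
  by rewrite mem_cat => /orP[/sI|/tI].
(* A unit c has no irreducible factors and is absorbed into q, whence a multiple q' in place of q
   itself. *)
move=> abE; suff : exists (q' : K) r, [/\ forall x, x \in q' :: r -> irreducible_elt x,
    divides q q' & a * b = \prod_(x <- q' :: r) x].
  case=> q' [r [rI qq']]; rewrite {1}aE {1}bE -big_cat /= => /esym rE.
  have [t' [tt' st' /(_ 0)]] := uniq _ _ rI stI rE.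
  case=> // u [Uu /= q'E].
  have t0 : t'`_0 \in s ++ t.
    by rewrite (perm_mem tt') mem_nth // -st'.
  have qt : divides q t'`_0.
    by apply: divides_trans qq' _; exists u^-1; rewrite q'E mulrC mulrK.
  move: t0; rewrite mem_cat => /orP[t0|t0]; [left; rewrite aE|right; rewrite bE];
    by rewrite (big_rem _ t0) /=; apply: divides_mulr.
have c0 : c != 0.
  by apply: contraNneq (mulf_neq0 a0 b0) => c0; rewrite abE c0 mul0r.
have [Uc|Uc] := boolP (c \is a GRing.unit).
  exists (c * q), [::]; split; last by rewrite big_seq1.
    move=> x; rewrite inE => /eqP->; split; first exact: mulf_neq0.
      by rewrite unitrM Uc.
    move=> d e dE; have [] := qP (c^-1 * d) e; first by rewrite -mulrA -dE mulKr.
      by rewrite unitrM => /andP[_]; left.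
    by right.
  exact/divides_mull/divides_refl.
have [r [rI cE]] := fact c c0 Uc.
exists q, r; split; last by rewrite abE cE big_cons mulrC.
  by move=> x; rewrite inE => /orP[/eqP->|/rI].
exact: divides_refl.
Qed.

Lemma ufd_factorial (K : idomainType) : is_ufd K -> factorial_dom K.
Proof.
move=> Kufd a a0; have [Ua|Ua] := boolP (a \is a GRing.unit).
  by exists a, [::]; rewrite big_nil mulr1.
have [s [sI ->]] := Kufd.1 a a0 Ua.
exists 1, s; rewrite unitr1 mul1r; split=> // x /sI.
exact: irreducible_prime.
Qed.

(** * Residue fields of prime ideals *)

Section PrimeQuotient.
Variables (A : idomainType) (g : A).
Hypothesis gP : prime_ideal g.

(** A Boolean form of the ideal generated by g, by excluded middle, since the quotient construction
    takes a Boolean predicate. *)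
Let I : {pred A} := fun a => if excluded_middle_informative (divides g a)
  then true else false.

Let inI a : reflect (divides g a) (a \in I).
Proof.
rewrite unfold_in /I; case: excluded_middle_informative => ga; exact: (iffP idP).
Qed.

Let I_ideal : idealr_closed I.
Proof.
split; first by apply/inI/divides0.
  by apply/inI=> /(divides_unitE (unitr1 _)); apply/negP/gP.1.
by move=> a x y /inI gx /inI gy; apply/inI/dividesD => //; apply: divides_mull.
Qed.

Let I_prime : prime_idealr_closed I.
Proof.
move=> a b /inI /gP.2[] gab; apply/orP; [left|right]; exact/inI.
Qed.

HB.instance Definition _ := isIdealr.Build A I I_ideal.
HB.instance Definition _ := isPrimeIdealrClosed.Build A I I_prime.

Let Q := {ideal_quot I}.
HB.instance Definition _ := GRing.ComNzRing.on Q.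

(** Units and inverses are chosen classically, to give Q the integral domain structure from which
    its field of fractions is formed. *)
Let Q_unit : pred Q := fun x =>
  if excluded_middle_informative (exists y, y * x = 1) then true else false.
Let Q_inv (x : Q) : Q :=
  if excluded_middle_informative (exists y, y * x = 1) is left ex
  then proj1_sig (constructive_indefinite_description _ ex) else x.

Let Q_mulVr : {in Q_unit, left_inverse 1 Q_inv *%R}.
Proof.
move=> x; rewrite unfold_in /Q_unit /Q_inv.
by case: excluded_middle_informative => // ex _; case: constructive_indefinite_description.
Qed.

Let Q_unitP (x y : Q) : y * x = 1 -> Q_unit x.
Proof.
by move=> yx; rewrite /Q_unit; case: excluded_middle_informative => // -[]; exists y.
Qed.

Let Q_inv_out : {in [predC Q_unit], Q_inv =1 id}.
Proof.
move=> x; rewrite inE unfold_in /Q_unit /Q_inv.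
by case: excluded_middle_informative.
Qed.

HB.instance Definition _ :=
  GRing.ComNzRing_hasMulInverse.Build Q Q_mulVr Q_unitP Q_inv_out.
HB.instance Definition _ := GRing.ComUnitRing_isIntegral.Build Q
  (@Quotient.rquot_IdomainAxiom A I).

(** The field is the fraction field of A/(g); for g = 0 it is that of A. *)
Lemma prime_quotient_field : exists (k : fieldType) (rho : {rmorphism A -> k}),
  (forall a, rho a = 0 <-> divides g a) /\
  (forall y, exists a b, rho b != 0 /\ y * rho b = rho a).
Proof.
pose pi : {rmorphism A -> Q} := \pi_Q%qT.
have pi0 a : pi a = 0 <-> divides g a.
  rewrite -(rmorph0 pi); split.
    move/eqP; rewrite -Quotient.idealrBE subr0; exact/inI.
  move=> ga; apply/eqP; rewrite -Quotient.idealrBE subr0; exact/inI.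
exists {fraction Q}, (@FracField.tofrac Q \o pi); split=> [a|y].
  by rewrite -pi0 /=; split=> [/eqP|->]; rewrite ?rmorph0 // tofrac_eq0 => /eqP.
elim/quotW: y => x; exists (repr (\n_x)), (repr (\d_x)).
have piK z : pi (repr z) = z by exact: reprK.
rewrite /= !piK tofrac_eq0 denom_ratioP; split=> //.
unlock FracField.tofrac; rewrite -[LHS]FracField.pi_mul.
apply/eqmodP; rewrite /= FracField.equivfE /FracField.mulf /=.
rewrite !numden_Ratio ?mulr1 ?oner_neq0 ?denom_ratioP //.
by rewrite mulrC.
Qed.

End PrimeQuotient.

(** * Gauss's lemma *)

Section PolyFactorial.
Variable R : idomainType.
Hypothesis fR : factorial_dom R.
Implicit Types (c q : R) (f h : {poly R}).

Lemma divides_polyC q f : divides q%:P f <-> forall i, divides q f`_i.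
Proof.
split=> [[h ->] i|qf]; first by rewrite coefMC; exists h`_i.
exists (\poly_(i < size f) proj1_sig (constructive_indefinite_description _ (qf i))).
apply/polyP=> i; rewrite coefMC coef_poly.
case: constructive_indefinite_description => c cE /=.
by case: ltnP => // /leq_sizeP/(_ _ (leqnn _)) ->; rewrite mul0r.
Qed.

(** Reduction of the coefficients modulo q maps into polynomials over a field, which form a domain,
    and its kernel consists of the multiples of q. *)
Lemma polyC_prime q : prime_elt q -> prime_elt q%:P.
Proof.
move=> [q0 qP]; split; first by rewrite polyC_eq0.
split; first by rewrite poly_unitE size_polyC coefC eqxx (negPf qP.1) andbF.
have [k [rho [rho0 _]]] := prime_quotient_field qP.
have div f : divides q%:P f <-> map_poly rho f = 0.
  rewrite divides_polyC; split=> [qf|/polyP f0 i].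
    by apply/polyP=> i; rewrite coef_map coef0; apply/rho0.
  by apply/rho0; have := f0 i; rewrite coef_map coef0.
move=> f h /div; rewrite rmorphM => /eqP; rewrite mulf_eq0.
by case/orP=> /eqP ?; [left|right]; apply/div.
Qed.

(** Prime constants replace a gcd of the coefficients. Over a ring without primes every polynomial
    is primitive, 0 included, so f != 0 is required separately. *)
Definition primitive f := forall q, prime_elt q -> ~ divides q%:P f.

Lemma primitive_divides f h : primitive h -> divides f h -> primitive f.
Proof. by move=> hP fh q /hP qh qf; apply/qh/(divides_trans qf). Qed.

Lemma primitive_const c : c != 0 -> primitive c%:P -> c%:P \is a GRing.unit.
Proof.
move=> c0 cP; rewrite poly_unitE size_polyC c0 coefC eqxx /=.
apply/negPn/negP => /(prime_factor fR c0)[q qP qc]; apply: (cP q qP).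
by apply/divides_polyC=> i; rewrite coefC; case: ifP => _ //; apply: divides0.
Qed.

Lemma primitive_size1 f : f != 0 -> primitive f -> (size f <= 1)%N ->
  f \is a GRing.unit.
Proof.
move=> f0 fP sf; move: fP f0; rewrite (size1_polyC sf) polyC_eq0 => fP f0.
exact: primitive_const.
Qed.

(** Induction on the number of prime factors of the leading coefficient: a prime constant dividing f
    divides that coefficient and cancels one of its factors. *)
Lemma content f : f != 0 ->
  exists c f0, [/\ c != 0, primitive f0 & f = c%:P * f0].
Proof.
move=> f0; have lf0 : lead_coef f != 0 by rewrite lead_coef_eq0.
have [u [s [Uu sP fE]]] := fR lf0; clear lf0.
have [n ns] := ubnP (size s); elim: n u s Uu sP f fE f0 ns => // n IHn.
move=> u s Uu sP f fE f0 ns.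
have [fP|] := classic (primitive f); first by exists 1, f; rewrite mul1r oner_eq0.
move/not_all_ex_not => [q] /not_all_ex_not [qP] /NNPP [h hE].
have lh : u * \prod_(x <- s) x = lead_coef h * q.
  by rewrite -fE hE lead_coefM lead_coefC.
have h0 : h != 0 by apply: contraNneq f0 => h0; rewrite hE h0 mul0r.
have : divides q (u * \prod_(x <- s) x) by rewrite lh; apply/divides_mull/divides_refl.
case/(qP.2.2).
  by move=> /(divides_unitE Uu); rewrite (negPf qP.2.1).
case/(prime_prod qP.2) => x xs [e xE].
have Ue : e \is a GRing.unit.
  have [//|Uq] := prime_irreducible (sP x xs) xE.
  by case/negP: qP.2.1.
case: (IHn (u * e) (rem x s) _ _ h) => //.
- by rewrite unitrM Uu.
- by move=> y /mem_rem /sP.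
- apply: (mulIf qP.1); rewrite -lh (big_rem x) //= xE; ring.
- by rewrite size_rem // -ltnS (ltn_predK (m := index x s)) ?index_mem.
move=> c [h' [c0 h'P h'E]]; exists (c * q), h'; split=> //.
  by rewrite mulf_neq0 // qP.1.
by rewrite hE h'E polyCM; ring.
Qed.

(** A prime factor q of c divides the product t f but not the primitive f, so it divides the
    cofactor t and can be cancelled. *)
Lemma primitive_divides_mulC f h c : primitive f -> c != 0 ->
  divides f (c%:P * h) -> divides f h.
Proof.
move=> fP /fR[u [s [Uu]]]; elim: s c u Uu h => [|q s IHs] c u Uu h sP ->.
  rewrite big_nil mulr1 => -[t tE]; exists (u^-1%:P * t).
  by rewrite -mulrA -tE mulrA -polyCM mulVr // mul1r.
have qP : prime_elt q by apply: sP; rewrite mem_head.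
rewrite big_cons => -[t tE].
have : divides q%:P (t * f).
  by rewrite -tE; exists ((u * \prod_(x <- s) x)%:P * h); rewrite !polyCM; ring.
have qP' := polyC_prime qP; case/qP'.2.2; last by move/(fP q qP).
case=> t' t'E; apply: (IHs (u * \prod_(x <- s) x) u Uu h) => [x xs||] //.
  by apply: sP; rewrite inE xs orbT.
exists t'; apply: (mulfI qP'.1).
by rewrite [LHS]mulrA -polyCM [q * _]mulrCA tE t'E; ring.
Qed.

(** Each prime factor of c divides q or h by [polyC_prime], and is moved out of whichever it
    divides. *)
Lemma mulC_factor f c (q h : {poly R}) : f != 0 -> c != 0 -> c%:P * f = q * h ->
  exists c1 c2 (q1 h1 : {poly R}),
    [/\ q = c1%:P * q1, h = c2%:P * h1 & f = q1 * h1].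
Proof.
move=> f0 /fR[u [s [Uu]]]; elim: s c u Uu q h => [|x s IHs] c u Uu q h sP ->.
  rewrite big_nil mulr1 => fE; exists u, 1, (u^-1%:P * q), h.
  by rewrite mul1r mulrA -polyCM mulrV // mul1r -mulrA -fE mulrA -polyCM mulVr // mul1r.
have xP : prime_elt x by apply: sP; rewrite mem_head.
have xP' := polyC_prime xP.
have sP' y : y \in s -> prime_elt y by move=> ys; apply: sP; rewrite inE ys orbT.
rewrite big_cons => fE.
have : divides x%:P (q * h).
  by rewrite -fE; exists ((u * \prod_(x <- s) x)%:P * f); rewrite !polyCM; ring.
case/xP'.2.2=> [][t tE].
- have [|c1 [c2 [q1 [h1 [tE' -> ->]]]]] := IHs _ u Uu t h sP' erefl.
    apply: (mulfI xP'.1).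
    transitivity ((u * (x * \prod_(y <- s) y))%:P * f); first by rewrite !polyCM; ring.
    by rewrite fE tE; ring.
  by exists (c1 * x), c2, q1, h1; split=> //; rewrite tE tE' polyCM; ring.
- have [|c1 [c2 [q1 [h1 [-> tE' ->]]]]] := IHs _ u Uu q t sP' erefl.
    apply: (mulfI xP'.1).
    transitivity ((u * (x * \prod_(y <- s) y))%:P * f); first by rewrite !polyCM; ring.
    by rewrite fE tE; ring.
  by exists c1, (c2 * x), q1, h1; split=> //; rewrite tE tE' polyCM; ring.
Qed.

(* With D a pseudo-gcd of f and h over R, irreducibility of f forces D to be a
   constant, and Bezout applies, or an R-multiple of f. *)
Lemma primitive_irreducible_prime f : f != 0 -> f \isn't a GRing.unit ->
    primitive f ->
    (forall a b, f = a * b -> a \is a GRing.unit \/ b \is a GRing.unit) ->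
  prime_elt f.
Proof.
move=> f0 Uf fP fI; split=> //; split=> // g h fgh.
set D := Pdiv.Idomain.gcdp f g.
have D0 : D != 0 by rewrite Pdiv.Idomain.gcdp_eq0 (negPf f0).
have /Pdiv.Idomain.dvdpP[[c q] /= c0] := Pdiv.Idomain.dvdp_gcdl f g.
rewrite -/D -mul_polyC => /(mulC_factor f0 c0)[c1 [c2 [q1 [h1 [_ DE fE]]]]].
have c20 : c2 != 0 by apply: contraNneq D0 => c20; rewrite DE c20 mul0r.
have [Uq1|Uh1] := fI _ _ fE.
  left; have /Pdiv.Idomain.dvdpP[[d e] /= d0] := Pdiv.Idomain.dvdp_gcdr f g.
  rewrite -/D -mul_polyC DE => dE.
  apply: (primitive_divides_mulC fP d0); exists (e * c2%:P * q1^-1).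
  by rewrite dE fE -!mulrA mulKr.
right; have [[v w] /=] := Pdiv.Idomain.Bezoutp f g.
rewrite -/D => /Pdiv.Idomain.eqpP[[d e] /= /andP[d0 e0]].
rewrite -!mul_polyC DE => dE.
apply: (@primitive_divides_mulC _ _ (e * c2)) => //; first exact: mulf_neq0.
have -> : (e * c2)%:P * h = h1^-1 * (d%:P * v * h * f + d%:P * w * (g * h)).
  apply: (mulrI Uh1); rewrite mulVKr //.
  transitivity ((d%:P * (v * f + w * g)) * h); last by ring.
  by rewrite dE polyCM; ring.
apply/divides_mull/dividesD; first exact/divides_mull/divides_refl.
exact: divides_mull.
Qed.

(** A factor of a primitive polynomial is primitive, so a non-unit factor has positive degree; both
    factors of a proper factorization thus have smaller degree than f. *)
Lemma primitive_factorial f : f != 0 -> primitive f ->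
  exists u s, [/\ u \is a GRing.unit, forall x, x \in s -> prime_elt x
      & f = u * \prod_(x <- s) x].
Proof.
have [n nf] := ubnP (size f); elim: n f nf => // n IHn f nf f0 fP.
have [Uf|Uf] := boolP (f \is a GRing.unit).
  by exists f, [::]; rewrite big_nil mulr1.
have [[a [b [fE [Ua Ub]]]]|nab] := classic (exists a b, f = a * b /\
    (a \isn't a GRing.unit /\ b \isn't a GRing.unit)); last first.
  exists 1, [:: f]; rewrite unitr1 big_seq1 mul1r; split=> // x; rewrite inE => /eqP->.
  apply: primitive_irreducible_prime => // a b fE.
  have [Ua|Ua] := boolP (a \is a GRing.unit); first by left.
  have [Ub|Ub] := boolP (b \is a GRing.unit); first by right.
  by case: nab; exists a, b.
have /andP[a0 b0] : (a != 0) && (b != 0) by rewrite -negb_or -mulf_eq0 -fE.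
have aP : primitive a.
  by apply: primitive_divides fP _; rewrite fE mulrC; apply/divides_mull/divides_refl.
have bP : primitive b.
  by apply: primitive_divides fP _; rewrite fE; apply/divides_mull/divides_refl.
have sa : (1 < size a)%N by rewrite ltnNge; apply: contra Ua; apply: primitive_size1.
have sb : (1 < size b)%N by rewrite ltnNge; apply: contra Ub; apply: primitive_size1.
move: nf; rewrite fE size_mul // => nf.
have [|u [s [Uu sP aE]]] := IHn a _ a0 aP; first by lia.
have [|v [t [Uv tP bE]]] := IHn b _ b0 bP; first by lia.
exists (u * v), (s ++ t); split; first by rewrite unitrM Uu.
  by move=> x; rewrite mem_cat => /orP[/sP|/tP].
by rewrite big_cat /= aE bE; ring.
Qed.

Lemma poly_factorial : factorial_dom {poly R}.
Proof.
move=> f f0; have [c [h [c0 hP fE]]] := content f0.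
have h0 : h != 0 by apply: contraNneq f0 => h0; rewrite fE h0 mulr0.
have [u [s [Uu sP cE]]] := fR c0; have [v [t [Uv tP hE]]] := primitive_factorial h0 hP.
exists (u%:P * v), (map polyC s ++ t); split.
- by rewrite unitrM Uv rmorph_unit.
- by move=> x; rewrite mem_cat => /orP[/mapP[y ys ->]|/tP//]; apply/polyC_prime/sP.
rewrite big_cat big_map /= fE hE cE rmorphM rmorph_prod /=; ring.
Qed.

End PolyFactorial.

Lemma factorial_iso (R S : idomainType) (phi : {rmorphism R -> S})
    (psi : {rmorphism S -> R}) :
  cancel phi psi -> cancel psi phi -> factorial_dom R -> factorial_dom S.
Proof.
move=> phiK psiK fR.
have div a b : divides (phi a) b <-> divides a (psi b).
  split=> [[c ->]|[c cE]]; first by exists (psi c); rewrite rmorphM phiK.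
  by exists (phi c); rewrite -rmorphM -cE psiK.
have prime a : prime_elt a -> prime_elt (phi a).
  move=> [a0 [Ua aP]]; split.
    by apply: contraNneq a0 => pa; rewrite -(phiK a) pa rmorph0.
  split=> [|b c /div]; last by rewrite rmorphM => /aP[] ?; [left|right]; apply/div.
  by apply: contra Ua => /(rmorph_unit psi); rewrite phiK.
move=> a a0; have pa0 : psi a != 0.
  by apply: contraNneq a0 => pa; rewrite -(psiK a) pa rmorph0.
have [u [s [Uu sP aE]]] := fR _ pa0.
exists (phi u), (map phi s); split; first exact: rmorph_unit.
  by move=> x /mapP[y ys ->]; apply/prime/sP.
by rewrite big_map -rmorph_prod -rmorphM -aE psiK.
Qed.

Lemma mpoly_ring_ind (R : nzRingType) n (P : {mpoly R[n]} -> Prop) :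
    (forall c, P c%:MP) -> (forall i, P 'X_i) ->
    (forall a b, P a -> P b -> P (a + b)) -> (forall a b, P a -> P b -> P (a * b)) ->
  forall a, P a.
Proof.
move=> PC PX PD PM; elim/mpolyind => [|c m a _ _ Pa]; first by rewrite -mpolyC0.
apply: PD => //; rewrite -mul_mpolyC mpolyXE_id; apply: (PM) => //.
apply: big_ind => [||i _]; [by rewrite -mpolyC1 | exact: (PM) |].
by elim: (m i) => [|e IHe]; rewrite ?expr0 ?exprS -?mpolyC1 //; apply: PM.
Qed.

Section RmorphFix.
Variables (R S : nzRingType) (f : {rmorphism R -> S}) (g : {rmorphism S -> R}).

Lemma rmorph_fixD a b : g (f a) = a -> g (f b) = b -> g (f (a + b)) = a + b.
Proof. by move=> aE bE; rewrite !rmorphD aE bE. Qed.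

Lemma rmorph_fixM a b : g (f a) = a -> g (f b) = b -> g (f (a * b)) = a * b.
Proof. by move=> aE bE; rewrite !rmorphM aE bE. Qed.

End RmorphFix.

Section MpolyFactorial.
Variables (K : idomainType) (n : nat).

(** Evaluation at the last variable, the inverse of [muni]; factoriality is transported along this
    isomorphism. *)
Let psi : {rmorphism {poly {mpoly K[n]}} -> {mpoly K[n.+1]}} :=
  horner_eval ('X_ord_max : {mpoly K[n.+1]}) \o map_poly (@mwiden n K).

Let muniX i : muni ('X_(widen_ord (leqnSn n) i) : {mpoly K[n.+1]}) = ('X_i)%:P.
Proof.
rewrite muniE msuppX big_seq1 mcoeffX eqxx scale1r mnm1E.
rewrite -val_eqE /= ltn_eqF // expr0 alg_polyC; congr ('X_[_])%:P.
by apply/mnmP=> j; rewrite mnmE !mnm1E -!val_eqE.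
Qed.

Let muniXmax : muni ('X_ord_max : {mpoly K[n.+1]}) = 'X.
Proof.
rewrite muniE msuppX big_seq1 mcoeffX eqxx scale1r mnm1E eqxx expr1.
rewrite (_ : [multinom _ | _ < _] = 0%MM) ?mpolyX0 ?scale1r //.
by apply/mnmP=> j; rewrite mnmE mnm1E mnm0E -val_eqE /= gtn_eqF.
Qed.

Let psiK : cancel (@muni n K) psi.
Proof.
elim/mpoly_ring_ind=> [c|i|a b aE bE|a b aE bE].
- by rewrite muniC /psi /= map_polyC /horner_eval /= hornerC mwidenC.
- have [->|ni] := eqVneq i ord_max.
    by rewrite muniXmax /psi /= map_polyX /horner_eval /= hornerX.
  have [j ->] : exists j, i = widen_ord (leqnSn n) j.
    have ltin : (i < n)%N.
      by move: (ltn_ord i) ni; rewrite -val_eqE /=; lia.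
    by exists (Ordinal ltin); apply: val_inj.
  rewrite muniX /psi /= map_polyC /horner_eval /= hornerC mwidenX.
  by rewrite mnmwiden1.
- exact (@rmorph_fixD _ _ (@muni n K) psi a b aE bE).
- exact (@rmorph_fixM _ _ (@muni n K) psi a b aE bE).
Qed.

Let muniK : cancel psi (@muni n K).
Proof.
have KC : forall a : {mpoly K[n]}, muni (mwiden a) = a%:P.
  elim/mpoly_ring_ind=> [c|i|a b aE bE|a b aE bE].
  - by rewrite mwidenC muniC.
  - by rewrite mwidenX mnmwiden1 muniX.
  - by rewrite mwidenD muniD aE bE polyCD.
  - by rewrite mwidenM muniM aE bE polyCM.
elim/poly_ind=> [|f a fE]; first by rewrite !rmorph0.
rewrite rmorphD rmorphM /= muniD muniM fE.
by rewrite /psi /= map_polyX map_polyC /horner_eval /= hornerX hornerC muniXmax KC.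
Qed.

Lemma muni_factorial : factorial_dom {mpoly K[n]} -> factorial_dom {mpoly K[n.+1]}.
Proof. by move=> /poly_factorial; apply: (factorial_iso muniK psiK). Qed.

End MpolyFactorial.

Lemma mpoly_factorial (K : idomainType) n :
  factorial_dom K -> factorial_dom {mpoly K[n]}.
Proof.
move=> fK; elim: n => [|n]; last exact: muni_factorial.
apply: (factorial_iso (phi := @mpolyC 0 K) (psi := @mcoeff 0 K 0%MM)) fK.
  by move=> c; rewrite /= mcoeffC eqxx mulr1.
exact: mpolyKC.
Qed.

(** * Subrings, greatest common divisors, and the ring of p-th powers *)

Definition subring (A : nzRingType) (S : A -> Prop) : Prop :=
  [/\ S 1, forall a b, S a -> S b -> S (a - b)
    & forall a b, S a -> S b -> S (a * b)].

Section Subring.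
Variables (A : nzRingType) (S : A -> Prop).
Hypothesis hS : subring S.

Lemma subring1 : S 1. Proof. by case: hS. Qed.

Lemma subringB a b : S a -> S b -> S (a - b). Proof. by case: hS => _ + _; apply. Qed.

Lemma subringM a b : S a -> S b -> S (a * b). Proof. by case: hS => _ _; apply. Qed.

Lemma subring0 : S 0.
Proof. by rewrite -(subrr 1); apply: subringB; apply: subring1. Qed.

Lemma subringN a : S a -> S (- a).
Proof. by rewrite -sub0r; apply: subringB; apply: subring0. Qed.

Lemma subringD a b : S a -> S b -> S (a + b).
Proof. by move=> Sa Sb; rewrite -[b]opprK; apply: subringB => //; apply: subringN. Qed.

Lemma subringX a e : S a -> S (a ^+ e).
Proof.
move=> Sa; elim: e => [|e IHe]; first by rewrite expr0; apply: subring1.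
by rewrite exprS; apply: subringM.
Qed.

Lemma subring_sum (I : Type) (r : seq I) (P : pred I) F :
  (forall i, P i -> S (F i)) -> S (\sum_(i <- r | P i) F i).
Proof.
by move=> SF; apply: big_ind => //; [apply: subring0 | apply: subringD].
Qed.

Lemma subring_prod (I : Type) (r : seq I) (P : pred I) F :
  (forall i, P i -> S (F i)) -> S (\prod_(i <- r | P i) F i).
Proof.
by move=> SF; apply: big_ind => //; [apply: subring1 | apply: subringM].
Qed.

Lemma subringMn a e : S a -> S (a *+ e).
Proof.
by move=> Sa; elim: e => [|e IHe]; rewrite ?mulr0n ?mulrS; [apply: subring0 | apply: subringD].
Qed.

Lemma subring_nat e : S e%:R.
Proof. exact/subringMn/subring1. Qed.

End Subring.

Lemma adjoin_subring (A : nzRingType) (B S : A -> Prop) : subring (adjoin B S).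
Proof. by split; [apply: adjoin1 | apply: adjoinB | apply: adjoinM]. Qed.

Lemma adjoin_min (A : nzRingType) (B S T : A -> Prop) : subring T ->
  (forall a, B a -> T a) -> (forall a, S a -> T a) -> forall a, adjoin B S a -> T a.
Proof.
move=> hT BT ST a; elim=> {a} [a /BT|a /ST||a b _ Ta _|a b _ Ta _] //.
- exact: subring1.
- exact: subringB.
- exact: subringM.
Qed.

Lemma adjoin_mono (A : nzRingType) (B S S' : A -> Prop) :
  (forall a, S a -> S' a) -> forall a, adjoin B S a -> adjoin B S' a.
Proof.
move=> SS'; apply: adjoin_min; first exact: adjoin_subring.
  exact: adjoin_base.
by move=> a /SS'; apply: adjoin_gen.
Qed.

(** The sums of this form are closed under multiplication by y, because y^q lies in T; hence they
    form a subring. *)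
Lemma adjoin_pow (A : comNzRingType) (T : A -> Prop) (y : A) q :
    subring T -> (0 < q)%N -> T (y ^+ q) ->
  forall a, adjoin T (fun x => x = y) a ->
  exists t : nat -> A, (forall e, T (t e)) /\ a = \sum_(e < q) t e * y ^+ e.
Proof.
move=> hT q0 Tyq.
pose V a := exists t : nat -> A, (forall e, T (t e)) /\ a = \sum_(e < q) t e * y ^+ e.
have VB a b : V a -> V b -> V (a - b).
  case=> t [Tt ->] [u [Tu ->]]; exists (fun e => t e - u e); split.
    by move=> e; apply: subringB.
  by rewrite -sumrB; apply: eq_bigr => e _; rewrite mulrBl.
have VT a : T a -> V a.
  move=> Ta; exists (fun e => if e == 0%N then a else 0); split.
    by move=> e; case: ifP => _ //; apply: subring0.
  case: q q0 {Tyq V VB} => // q _.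
  by rewrite big_ord_recl /= expr0 mulr1 big1 ?addr0 // => i _; rewrite mul0r.
have V0 : V 0 by apply/VT/(subring0 hT).
have VD a b : V a -> V b -> V (a + b).
  move=> Va Vb; rewrite -[b]opprK; apply: (VB) => //.
  by rewrite -sub0r; apply: (VB).
have VTM c a : T c -> V a -> V (c * a).
  move=> Tc [t [Tt ->]]; exists (fun e => c * t e); split.
    by move=> e; apply: subringM.
  by rewrite mulr_sumr; apply: eq_bigr => e _; rewrite mulrA.
have Vexp e : (e < q)%N -> V (y ^+ e).
  move=> eq; exists (fun d => (d == e)%:R); split; first by move=> d; apply: subring_nat.
  rewrite (bigD1 (Ordinal eq)) //= eqxx mul1r big1 ?addr0 // => i.
  by rewrite -val_eqE /= => /negPf->; rewrite mul0r.
have VyM a : V a -> V (y * a).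
  case=> t [Tt ->]; rewrite mulr_sumr; apply: big_ind => [||e _].
  - exact: V0.
  - exact: (VD).
  rewrite mulrCA -exprS; apply: (VTM) => //.
  have [eq|] := ltnP e.+1 q; first exact: Vexp.
  move=> qe; have -> : e.+1 = q by apply/eqP; rewrite eqn_leq qe ltn_ord.
  exact: VT.
have VyeM e a : V a -> V (y ^+ e * a).
  elim: e a => [|e IHe] a Va; first by rewrite expr0 mul1r.
  by rewrite exprSr -mulrA; apply/IHe/VyM.
apply: (@adjoin_min _ _ _ V) => // [|a ->].
  split=> //; first exact/VT/(subring1 hT).
  move=> a b [t [Tt ->]] Vb; rewrite mulr_suml; apply: big_ind => [||e _].
  - exact: V0.
  - exact: (VD).
  by rewrite -mulrA; apply/(VTM)/VyeM.
rewrite -(mulr1 y); exact/VyM/VT/(subring1 hT).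
Qed.

Section Gcd.
Variable A : idomainType.
Hypothesis fA : factorial_dom A.
Hypothesis exA : exists q : A, prime_elt q.

(** All gcd conditions are used in this primewise form. A prime has to exist: otherwise the right
    side would hold also for S = {0}, whose gcd is 0. *)
Lemma gcd1P (S : A -> Prop) :
  (exists g, is_gcd S g /\ associated g 1) <->
  (forall q, prime_elt q -> exists2 a, S a & ~ divides q a).
Proof.
split=> [[g [[_ gS] [u [Uu gE]]]] q qP|Sq].
  apply: NNPP => nS; move/negP: qP.2.1; apply.
  have: divides q g.
    by apply: gS => a Sa; apply: NNPP => qa; apply: nS; exists a.
  by rewrite gE mul1r; apply: divides_unitE.
exists 1; split; last by exists 1; rewrite unitr1 mulr1.
split=> [a _|d dS]; first by exists a; rewrite mulr1.
apply: divides_unit; apply/negPn/negP => Ud.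
have [q qP qd] := prime_factor0 fA exA Ud.
by have [a Sa] := Sq q qP; case; apply: divides_trans (dS a Sa).
Qed.

Lemma gcd_sim1P (a b : A) :
  gcd_sim1 a b <-> (forall q, prime_elt q -> divides q a -> divides q b -> False).
Proof.
rewrite /gcd_sim1 gcd1P; split=> ab q qP.
  by move=> qa qb; have [c [->|->]] := ab q qP.
have [qa|qa] := classic (divides q a); last by exists a; [left|].
by exists b; [right | move/(ab q qP qa)].
Qed.

End Gcd.

Lemma msize_mderiv (R : nzRingType) n (q : {mpoly R[n]}) l :
  mderiv l q != 0 -> (msize (mderiv l q) < msize q)%N.
Proof.
move=> d0; have := mlead_supp d0; rewrite mcoeff_msupp mcoeff_deriv => md.
have : (mlead (mderiv l q) + U_(l))%MM \in msupp q.
  by rewrite mcoeff_msupp; apply: contraNneq md => ->; rewrite mul0rn.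
by move/msize_mdeg_lt; rewrite mdegD mdeg1 addn1 mlead_deg.
Qed.

Section PowerRing.
Variables (K : idomainType) (n p : nat).
Hypothesis hp : p \in [pchar K].
Local Notation A := {mpoly K[n]}.
Local Notation B := (@ppow_ring K n p).

Lemma pchar_mpoly : p \in [pchar A].
Proof.
rewrite inE (pcharf_prime hp) /= -mpolyC_nat (pcharf0 hp) mpolyC0 eqxx //.
Qed.

Lemma mderiv_exp l (a : A) e : mderiv l (a ^+ e) = (a ^+ e.-1 * mderiv l a) *+ e.
Proof.
elim: e => [|e IHe]; first by rewrite expr0 -mpolyC1 mderivC mulr0n.
rewrite exprS mderivM IHe mulrS mulrC /=; congr (_ + _).
by case: e {IHe} => [|e]; rewrite ?mulr0n ?mulr0 // -mulrnAr mulrA -exprS mulrnAr.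
Qed.

Lemma mderiv_pexp l (a : A) : mderiv l (a ^+ p) = 0.
Proof. by rewrite mderiv_exp -mulr_natr (pcharf0 pchar_mpoly) mulr0. Qed.

Lemma ppow_subring : subring B.
Proof. exact: adjoin_subring. Qed.

(** For the converse, a vanishing derivative means that m i times the nonzero coefficient of each
    monomial m is 0, so p divides m i. *)
Lemma ppowP a : B a <-> forall l, mderiv l a = 0.
Proof.
split=> [|a0].
  elim=> {a} [_ [c ->]|_ [i ->]||a b _ a0 _ b0|a b _ a0 _ b0] l.
  - exact: mderivC.
  - exact: mderiv_pexp.
  - by rewrite -mpolyC1 mderivC.
  - by rewrite mderivB a0 b0 subrr.
  - by rewrite mderivM a0 b0 mul0r mulr0 addr0.
rewrite [a]mpolyE big_seq; apply: (subring_sum ppow_subring) => m ma.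
rewrite -mul_mpolyC; apply: (subringM ppow_subring).
  by apply: adjoin_base; exists a@_m.
rewrite mpolyXE_id; apply: (subring_prod ppow_subring) => i _.
suff /dvdnP[d ->] : (p %| m i)%N.
  by rewrite mulnC exprM; apply: (subringX ppow_subring); apply: adjoin_gen; exists i.
have [->//|mi0] := posnP (m i).
have := mcoeff_deriv i (m - U_(i))%MM a; rewrite a0 mcoeff0 => /esym/eqP.
rewrite submK; last by apply/mnm_lepP=> j; rewrite mnm1E; case: eqP => // <-.
rewrite mnmBE mnm1E eqxx subn1 prednK // -mulr_natr mulf_eq0.
by rewrite (negPf (_ : a@_m != 0)) -?mcoeff_msupp //= (dvdn_pcharf hp).
Qed.

Lemma ppow_exp (a : A) : B (a ^+ p).
Proof. by apply/ppowP=> l; apply: mderiv_pexp. Qed.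

Lemma mpoly_has_prime : factorial_dom K -> (0 < n)%N -> exists q : A, prime_elt q.
Proof.
move=> fK n0; have fA := mpoly_factorial (n := n) fK; pose i := Ordinal n0.
have [] := prime_factor fA (_ : ('X_i : A) != 0); last by move=> q; exists q.
  by rewrite -msize_poly_eq0 msizeX.
rewrite qualifE /= /mpoly_unit mcoeffX -[_ == 0%MM]negbK.
have -> /= : U_(i)%MM != 0%MM :> 'X_{1..n}.
  by apply/eqP=> /mnmP/(_ i); rewrite mnm1E mnm0E eqxx.
by rewrite unitr0 andbF.
Qed.

(* A derivative of g has smaller degree, so it is a multiple of g only if it
   vanishes. *)
Lemma divides_mderivs (g : A) :
  (forall l, divides g (mderiv l g)) -> B g.
Proof.
move=> gd; apply/ppowP=> l; apply/eqP/negPn/negP => d0.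
have [c cE] := gd l; have g0 : g != 0.
  by apply: contraNneq d0 => ->; rewrite mderiv0.
have c0 : c != 0 by apply: contraNneq d0 => c0; rewrite cE c0 mul0r.
have : (msize g <= msize (mderiv l g))%N.
  by rewrite cE msizeM // (mpolySpred _ c0) addSn leq_addl.
by rewrite leqNgt msize_mderiv.
Qed.

End PowerRing.

(** * Purely inseparable extensions of exponent one *)

Section PowerIndependence.
Variables (k : fieldType) (p : nat) (F : k -> Prop).
Hypotheses (hp : p \in [pchar k]) (hF : subring F) (Fp : forall c, F (c ^+ p)).

Let p_gt0 : (0 < p)%N := prime_gt0 (pcharf_prime hp).

(** F is a field, because c^-1 is the product of c^(p-1) and the p-th power of c^-1. *)
Lemma subring_inv c : F c -> F c^-1.
Proof.
move=> Fc; have [->|c0] := eqVneq c 0; first by rewrite invr0; apply: subring0.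
rewrite (_ : c^-1 = c ^+ p.-1 * c^-1 ^+ p); first by apply: subringM => //; apply: subringX.
by rewrite -[in RHS](prednK p_gt0) exprS mulrCA exprVn mulfV ?mulr1 // expf_neq0.
Qed.

(** The leading coefficient is multiplied by the degree, which lies between 1 and p - 1 and so is
    nonzero in k. *)
Lemma horner_natmul_neq0 (P : {poly k}) : (1 < size P <= p)%N -> P^`() != 0.
Proof.
case/andP=> sP sPp; apply/eqP=> /polyP/(_ (size P).-2).
rewrite coef_deriv coef0 -mulr_natr prednK; last by case: (size P) sP => [|[]].
move/eqP; rewrite mulf_eq0 -/(lead_coef P) lead_coef_eq0 -size_poly_eq0.
rewrite -(dvdn_pcharf hp) gtnNdvd ?orbF; [|lia|lia].
by case: (size P) sP.
Qed.

(* A polynomial P over F of least degree vanishing at x divides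
   'X^p - x^p = ('X - x)^p and, its derivative having smaller degree, has x as a
   simple root; hence it is linear. *)
Lemma annihilator_eq0 x (P : {poly k}) : ~ F x ->
  (forall i, F P`_i) -> (size P <= p)%N -> P.[x] = 0 -> P = 0.
Proof.
move=> nFx; have [m] := ubnP (size P); elim: m P => // m IHm P sPm FP sPp Px.
apply/eqP/negPn/negP => P0.
have sP1 : (1 < size P)%N.
  rewrite ltnNge; apply/negP => /size1_polyC PE; move: P0 Px.
  by rewrite PE polyC_eq0 hornerC => /eqP.
pose Q : {poly k} := (lead_coef P)^-1 *: P.
have l0 : lead_coef P != 0 by rewrite lead_coef_eq0.
have FQ i : F Q`_i.
  by rewrite coefZ; apply: subringM => //; apply: subring_inv; apply: FP.
have sQ : size Q = size P by rewrite size_scale // invr_neq0.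
have Qx : Q.[x] = 0 by rewrite hornerZ Px mulr0.
have Qtop : Q`_(size P).-1 = 1 by rewrite coefZ mulVf.
clearbody Q.
have Qmin (S : {poly k}) : (forall i, F S`_i) -> (size S < size P)%N -> S.[x] = 0 -> S = 0.
  move=> FS sS; apply: (IHm S) => //; first exact: leq_trans sS sPm.
  exact: ltnW (leq_trans sS sPp).
(* Division by the monic Q keeps the coefficients in F, and the remainder vanishes by minimality. *)
have Qdvd r (S : {poly k}) : (size S <= r)%N -> (forall i, F S`_i) -> S.[x] = 0 ->
    Q %| S.
  elim: r S => [|r IHr] S sS FS Sx.
    by move: sS; rewrite size_poly_leq0 => /eqP->; apply: dvdp0.
  have [rP|Pr] := ltnP r.+1 (size P).
    by rewrite (Qmin S) ?dvdp0 //; apply: leq_ltn_trans rP.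
  pose M := S`_r *: ('X^(r - (size P).-1) * Q).
  have -> : S = (S - M) + M by rewrite subrK.
  apply: dvdp_add; last by rewrite /M -mul_polyC mulrA dvdp_mull.
  apply: IHr => [|i|].
  - apply/leq_sizeP=> i; rewrite leq_eqVlt => /orP[/eqP<-|ri].
      rewrite coefB coefZ coefXnM ltnNge leq_subr /= subKn ?Qtop ?mulr1 ?subrr //.
      by rewrite -subn1 leq_subLR add1n.
    have Si : S`_i = 0 by apply/(leq_sizeP _ _ sS).
    rewrite coefB coefZ coefXnM Si; case: ifP => _; first by rewrite mulr0 subrr.
    rewrite [Q`_ _]nth_default ?mulr0 ?subrr // sQ.
    have sP0 : (0 < size P)%N by apply: ltnW.
    rewrite -(prednK sP0) in Pr *; move: ri; set e := (size P).-1 in Pr *; clearbody e.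
    by move: Pr; clear; lia.
  - rewrite coefB coefZ coefXnM; apply: subringB => //; apply: subringM => //.
    by case: ifP => _ //; apply: subring0.
  - by rewrite hornerD hornerN hornerZ hornerM Qx Sx !mulr0 subrr.
have : Q %| ('X - x%:P) ^+ p.
  have pP : p \in [pchar {poly k}] by rewrite pchar_poly.
  rewrite -[_ ^+ p]/(pFrobenius_aut pP _) rmorphB /= !pFrobenius_autE.
  apply: Qdvd (leqnn _) _ _ => [i|].
    rewrite -polyC_exp coefB coefXn coefC; apply: subringB => //.
      exact: subring_nat.
    by case: ifP => _ //; apply: subring0.
  by rewrite hornerD hornerN !horner_exp hornerX hornerC subrr.
case/Pdiv.Idomain.dvdp_exp_XsubCP => j _ /Pdiv.Idomain.eqpP[[c1 c2] /= /andP[c10 c20] QE].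
have Q'x : (Q^`()).[x] != 0.
  apply/eqP=> Q'x; have := @horner_natmul_neq0 Q; rewrite sQ sP1 sPp => /(_ isT)/eqP; apply.
  apply: Qmin => // [i|]; first by rewrite coef_deriv; apply: subringMn.
  by rewrite -sQ lt_size_deriv // -size_poly_eq0 sQ; case: (size P) sP1.
(* Up to a constant, Q is the j-th power of 'X - x: j = 0 contradicts Q(x) = 0, j = 1 puts x in F,
   and j > 1 contradicts [Q'x]. *)
case: j QE => [|[|j]] QE.
- by move/(congr1 (fun S : {poly k} => S.[x])): QE; rewrite !hornerZ Qx mulr0 expr0 hornerC mulr1 => /esym/eqP; rewrite (negPf c20).
- have /(congr1 (fun S : {poly k} => S`_0)) := QE; have /(congr1 (fun S : {poly k} => S`_1)) := QE.
  rewrite expr1 !coefZ !coefB !coefX !coefC /= subr0 sub0r mulr1 => E1 E0.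
  have Q10 : Q`_1 != 0 by apply: contraNneq c20 => Q10; rewrite -E1 Q10 mulr0.
  have Q0E : Q`_0 = - (Q`_1 * x) by apply: (mulfI c10); rewrite E0 -E1; ring.
  apply: nFx; rewrite (_ : x = - (Q`_0 * (Q`_1)^-1)).
    by apply: subringN => //; apply: subringM => //; apply: subring_inv; apply: FQ.
  by rewrite Q0E; field.
case/negP: Q'x; move/(congr1 (fun S : {poly k} => (S^`()).[x])): QE.
rewrite !derivZ !hornerZ deriv_exp hornerMn hornerM horner_exp hornerXsubC subrr exprS mul0r mulr0 mul0rn mulr0.
by move/eqP; rewrite mulf_eq0 (negPf c10).
Qed.

Lemma power_independence x (a : nat -> k) : ~ F x -> (forall e, F (a e)) ->
  \sum_(e < p) a e * x ^+ e = 0 -> forall e, (e < p)%N -> a e = 0.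
Proof.
move=> nFx Fa ax e ep; suff /polyP/(_ e) : \poly_(e < p) a e = 0.
  by rewrite coef_poly ep coef0.
apply: annihilator_eq0 nFx _ (size_poly _ _) _ => [i|]; last by rewrite horner_poly.
by rewrite coef_poly; case: ifP => _ //; apply: subring0.
Qed.
End PowerIndependence.

(* A derivation D on a subfield E of k is encoded by the subring
   {a + D(a) 'X + O('X^2) | a in E} of k[X]: a subring that contains 'X^2 k[X] is
   of this form when it contains no c 'X + O('X^2) with c != 0. *)
Definition dual_graph (k : fieldType) (p : nat) (T : {poly k} -> Prop) : Prop :=
  [/\ subring T, forall c : k, T (c ^+ p)%:P, forall Q, T ('X^2 * Q)
    & forall P, T P -> P`_0 = 0 -> P`_1 = 0].

Definition dual_dom (k : fieldType) (T : {poly k} -> Prop) (x : k) : Prop :=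
  exists2 P, T P & P`_0 = x.

Section DualGraph.
Variables (k : fieldType) (p : nat).
Hypothesis hp : p \in [pchar k].
Implicit Types (T : {poly k} -> Prop) (P Q : {poly k}) (x u w z c : k).

Let p_gt1 : (1 < p)%N := prime_gt1 (pcharf_prime hp).

Lemma coef1M P Q : (P * Q)`_1 = P`_1 * Q`_0 + P`_0 * Q`_1.
Proof. by rewrite coefM !big_ord_recl big_ord0 addr0 addrC. Qed.

(** The graph point that prescribes the value D(x) = u. *)
Definition dualX x u : {poly k} := x%:P + u *: 'X.

Lemma dualX_coef0 x u : (dualX x u)`_0 = x.
Proof. by rewrite coefD coefC coefZ coefX mulr0 addr0. Qed.

Lemma dualX_coef1 x u : (dualX x u)`_1 = u.
Proof. by rewrite coefD coefC coefZ coefX mulr1 add0r. Qed.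

Lemma coef0_exp P e : (P ^+ e)`_0 = P`_0 ^+ e.
Proof. by elim: e => [|e IHe]; rewrite ?expr0 ?coef1 // !exprS coef0M IHe. Qed.

Lemma coef1_exp P e : (P ^+ e)`_1 = (P`_0 ^+ e.-1 * P`_1) *+ e.
Proof.
elim: e => [|e IHe]; first by rewrite expr0 coef1 mulr0n.
rewrite exprS coef1M IHe coef0_exp mulrS mulrC; congr (_ + _).
by case: e {IHe} => [|e]; rewrite ?mulr0n ?mulr0 // mulrnAr mulrA -exprS.
Qed.

(** By Frobenius the power is x^p + u^p 'X^p, and 'X^p is a multiple of 'X^2. *)
Lemma dualX_expp T x u : dual_graph p T -> T (dualX x u ^+ p).
Proof.
case=> hT Tp TX _; have pP : p \in [pchar {poly k}] by rewrite pchar_poly.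
rewrite -(pFrobenius_autE pP) pFrobenius_autD_comm; last exact: mulrC.
rewrite !pFrobenius_autE -polyC_exp exprZn; apply: subringD => //.
have -> : 'X^p = 'X^2 * 'X^(p - 2) :> {poly k} by rewrite -exprD subnKC.
by rewrite scalerAr; apply: TX.
Qed.

Lemma dual_dom_subring T : dual_graph p T -> subring (dual_dom T).
Proof.
case=> hT _ _ _; split.
- by exists 1; rewrite ?coef1 //; apply: subring1.
- by move=> _ _ [P TP <-] [Q TQ <-]; exists (P - Q); rewrite ?coefB //; apply: subringB.
- by move=> _ _ [P TP <-] [Q TQ <-]; exists (P * Q); rewrite ?coef0M //; apply: subringM.
Qed.

Lemma dual_dom_exp T c : dual_graph p T -> dual_dom T (c ^+ p).
Proof. by case=> _ Tp _ _; exists (c ^+ p)%:P; rewrite ?coefC. Qed.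

Section Extend.
Variables (T : {poly k} -> Prop) (x u : k).
Hypothesis hT : dual_graph p T.

Definition dual_extend : {poly k} -> Prop := adjoin T (fun y => y = dualX x u).

Lemma dual_extend_sum P : dual_extend P -> exists t : nat -> {poly k},
  [/\ forall e, T (t e), P`_0 = \sum_(e < p) (t e)`_0 * x ^+ e
    & P`_1 = \sum_(e < p) ((t e)`_1 * x ^+ e + (t e)`_0 * (x ^+ e.-1 * u) *+ e)].
Proof.
have [hT1 _ _ _] := hT.
case/(adjoin_pow hT1 (ltnW p_gt1) (dualX_expp x u hT)) => t [Tt ->]; exists t; split=> //; rewrite coef_sum; apply: eq_bigr => e _.
  by rewrite coef0M coef0_exp dualX_coef0.
by rewrite coef1M coef0_exp coef1_exp dualX_coef0 dualX_coef1 mulrnAr.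
Qed.

Lemma dual_extend_indep (a : nat -> k) : ~ dual_dom T x ->
  (forall e, dual_dom T (a e)) -> \sum_(e < p) a e * x ^+ e = 0 ->
  forall e, (e < p)%N -> a e = 0.
Proof.
apply: (power_independence hp (dual_dom_subring hT)) => c; exact: dual_dom_exp.
Qed.

(** Outside its domain E a derivation may be given any value u at x: the powers x^e with e < p are
    independent over E, so a sum with value 0 has coefficients with value 0, hence with derivative
    0. *)
Lemma dual_graph_extend : ~ dual_dom T x -> dual_graph p dual_extend.
Proof.
move=> nTx; have [hT1 Tp TX T0] := hT; split=> [|c|Q|P].
- exact: adjoin_subring.
- exact/adjoin_base/Tp.
- exact/adjoin_base/TX.
move=> /dual_extend_sum[t [Tt -> ->]] t0.
have t00 := dual_extend_indep nTx (fun e => ex_intro2 _ _ (t e) (Tt e) erefl) t0.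
rewrite big1 // => e _.
by rewrite t00 // (T0 (t e)) ?t00 // !mul0r mul0rn addr0.
Qed.

End Extend.

(** The elements outside the domain are adjoined one at a time, with derivative 0. *)
Lemma dual_graph_total T (xs : seq k) : dual_graph p T ->
  exists T' : {poly k} -> Prop, [/\ dual_graph p T', forall P, T P -> T' P
    & forall x, x \in xs -> dual_dom T' x].
Proof.
elim: xs T => [|x xs IHxs] T hT; first by exists T.
suff [T1 [hT1 TT1 T1x]] : exists T1 : {poly k} -> Prop,
    [/\ dual_graph p T1, forall P, T P -> T1 P & dual_dom T1 x].
  have [T' [hT' T1T' T'xs]] := IHxs T1 hT1; exists T'; split=> // [P /TT1/T1T' //|y].
  rewrite inE => /orP[/eqP->|/T'xs //].
  by have [P /T1T' T'P Px] := T1x; exists P.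
have [Tx|nTx] := classic (dual_dom T x); first by exists T.
exists (dual_extend T x 0); split; first exact: dual_graph_extend.
  exact: adjoin_base.
by exists (dualX x 0); rewrite ?dualX_coef0 //; apply: adjoin_gen.
Qed.

Section OverSubring.
Variable F : k -> Prop.
Hypotheses (hF : subring F) (Fp : forall c, F (c ^+ p)).

(** The graph of the zero derivation on F. *)
Definition dual_const : {poly k} -> Prop := fun P => F P`_0 /\ P`_1 = 0.

Lemma dual_const_graph : dual_graph p dual_const.
Proof.
split=> [|c|Q|P [_ P1] //].
- split; first by rewrite /dual_const !coef1; split=> //; apply: subring1.
    move=> P Q [FP P1] [FQ Q1]; rewrite /dual_const !coefB P1 Q1 subrr.
    by split=> //; apply: subringB.
  move=> P Q [FP P1] [FQ Q1]; rewrite /dual_const coef0M coef1M P1 Q1 mul0r mulr0 addr0.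
  by split=> //; apply: subringM.
- by rewrite /dual_const !coefC; split; first exact: Fp.
- by rewrite /dual_const !coefXnM; split=> //; apply: subring0.
Qed.

Lemma dual_const_dom x : dual_dom dual_const x -> F x.
Proof. by case=> P [+ _] <-. Qed.

(* k admits a derivation vanishing on F but not on z. *)
Lemma dual_graph_separating z (xs : seq k) : ~ F z ->
  exists T : {poly k} -> Prop, [/\ dual_graph p T, forall P, dual_const P -> T P,
    T (dualX z 1) & forall x, x \in xs -> dual_dom T x].
Proof.
move=> nFz; have hT0 := dual_const_graph.
have hT1 : dual_graph p (dual_extend dual_const z 1).
  by apply: dual_graph_extend => // /dual_const_dom.
have [T [hT T1T Txs]] := dual_graph_total xs hT1.
exists T; split=> // [P cP|]; apply: T1T; first exact: adjoin_base.
exact: adjoin_gen.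
Qed.

(* Adjoining x with D(x) = w x adds e w (0 <= e < p) to the eigenvalues of D lying in
   F, so 0 remains an eigenvalue only on F if w avoids finitely many values. *)
Definition eigen_bounded T (L : seq k) : Prop :=
  (forall P, T P -> dual_dom T P`_1) /\
  (forall P c, T P -> F c -> P`_0 != 0 -> P`_1 = c * P`_0 ->
     c \in L /\ (c = 0 -> F P`_0)).

Lemma dual_graph_eigen (xs : seq k) :
    (forall s : seq k, exists2 w, F w & w \notin s) ->
  exists T : {poly k} -> Prop, [/\ dual_graph p T, forall P, dual_const P -> T P,
    forall x, x \in xs -> dual_dom T x & exists L, eigen_bounded T L].
Proof.
move=> Finf; elim: xs => [|x xs [T [hT cT Txs [L [TD TL]]]]].
  exists dual_const; split=> //; first exact: dual_const_graph.
  exists [:: 0]; split=> [P [_ ->]|P c [FP ->] _ P0 /esym/eqP].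
    exists 0; rewrite ?coef0 // /dual_const !coef0; split=> //; exact: subring0.
  by rewrite mulf_eq0 (negPf P0) orbF inE.
have [Tx|nTx] := classic (dual_dom T x).
  exists T; split=> // [y|]; first by rewrite inE => /orP[/eqP->|/Txs].
  by exists L.
(* The values - c / e are those for which c + e w = 0 with c in L; the entries for e = 0 are the
   default value 0. *)
have [w Fw wL] := Finf [seq - c / e%:R | c <- L, e <- iota 0 p].
exists (dual_extend T x (w * x)).
have hT' := dual_graph_extend (w * x) hT nTx.
have baseT P : T P -> dual_extend T x (w * x) P by apply: adjoin_base.
have dom_base y : dual_dom T y -> dual_dom (dual_extend T x (w * x)) y.
  by case=> P /baseT TP <-; exists P.
have dom_x : dual_dom (dual_extend T x (w * x)) x.
  by exists (dualX x (w * x)); rewrite ?dualX_coef0 //; apply: adjoin_gen.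
have FT c : F c -> dual_dom T c.
  by move=> Fc; exists c%:P; rewrite ?coefC //; apply: cT; rewrite /dual_const !coefC.
(* With D(x) = w x, the derivative of t x^e is (D(t) + e w t) x^e, so D respects the decomposition
   by powers of x. *)
have D1 P : dual_extend T x (w * x) P -> exists t : nat -> {poly k},
  [/\ forall e, T (t e), P`_0 = \sum_(e < p) (t e)`_0 * x ^+ e
    & P`_1 = \sum_(e < p) ((t e)`_1 + w * (t e)`_0 *+ e) * x ^+ e].
  move=> /(dual_extend_sum hT)[t [Tt P0 P1]]; exists t; split=> //; rewrite P1.
  apply: eq_bigr => -[[|e] ep] _ /=; first by rewrite !mulr0n !addr0.
  rewrite mulrDl; congr (_ + _); rewrite exprS; ring.
have hS := dual_dom_subring hT; have hS' := dual_dom_subring hT'.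
split=> // [P /cT/baseT //|y|].
  by rewrite inE => /orP[/eqP->|/Txs/dom_base].
exists [seq c + w *+ e | c <- L, e <- iota 0 p]; split=> [P /D1[t [Tt _ ->]]|P c].
  apply: (subring_sum hS') => e _; apply: (subringM hS'); last exact: (subringX hS').
  apply: dom_base; apply: (subringD hS); first exact: TD.
  apply: (subringMn hS); apply: (subringM hS); first exact: FT.
  by exists (t e).
move=> /D1[t [Tt -> ->]] Fc t0 tc.
(* Comparing coefficients of x^e: each t_e satisfies the eigenvector equation for c - e w. *)
have eig e : (e < p)%N -> (t e)`_1 = (c - w *+ e) * (t e)`_0.
  move=> ep; apply/eqP; rewrite -subr_eq0; apply/eqP.
  apply: (dual_extend_indep hT nTx (a := fun e => (t e)`_1 - (c - w *+ e) * (t e)`_0)) ep.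
    move=> d; apply: (subringB hS); first exact: TD.
    apply: (subringM hS); last by exists (t d).
    by apply: FT; apply: (subringB hF) => //; apply: (subringMn hF).
  move/eqP: tc; rewrite -subr_eq0 mulr_sumr -sumrB => /eqP tc; rewrite -[RHS]tc.
  by apply: eq_bigr => d _; ring.
have Fce e : F (c - w *+ e) by apply: (subringB hF) => //; apply: (subringMn hF).
have [d dp td] : exists2 d, (d < p)%N & (t d)`_0 != 0.
  apply: NNPP => nt; case/negP: t0; apply/eqP; apply: big1 => e _.
  suff -> : (t e)`_0 = 0 by rewrite mul0r.
  by apply/eqP/negPn/negP => te; apply: nt; exists (e : nat).
have [cL _] := TL _ _ (Tt d) (Fce d) td (eig d dp); split.
  apply/allpairsP; exists (c - w *+ d, d); rewrite mem_iota subrK; split=> //=.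
(* A nonzero t_e with e > 0 would put - e w into L, which the choice of w forbids; only the term e =
   0 remains. *)
move=> c0; have tn0 e : (0 < e < p)%N -> (t e)`_0 = 0.
  case/andP=> e0 ep; apply/eqP/negPn/negP => te.
  have [ceL _] := TL _ _ (Tt e) (Fce e) te (eig e ep).
  case/negP: wL; apply/allpairsP; exists (c - w *+ e, e); rewrite mem_iota; split=> //=.
  rewrite c0 sub0r opprK -(mulr_natr w) mulfK // -(dvdn_pcharf hp) gtnNdvd //.
have p0 : (0 < p)%N := ltnW p_gt1.
rewrite (bigD1 (Ordinal p0)) //= expr0 mulr1 big1 ?addr0; last first.
  move=> e; rewrite -val_eqE /= => e0; rewrite tn0 ?mul0r // lt0n e0 /=; exact: ltn_ord.
have [->|t00] := eqVneq (t 0%N)`_0 0; first exact: subring0.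
have [_ +] := TL _ _ (Tt 0%N) (Fce 0%N) t00 (eig 0%N p0); apply.
by rewrite c0 mulr0n subr0.
Qed.

End OverSubring.
End DualGraph.

Lemma minor_neq0 (k : fieldType) m n (M : 'M[k]_(m, n)) :
    (forall a : 'rV_m, a *m M = 0 -> a = 0) ->
  exists j : 'I_m -> 'I_n, \det (\matrix_(i < m, l < m) M i (j l)) != 0.
Proof.
move=> M0; have fM : row_full M^T.
  rewrite /row_full mxrank_tr -/(row_free M) -kermx_eq0.
  by apply/eqP/row_matrixP=> i; rewrite row0; apply: M0; rewrite -row_mul mulmx_ker row0.
have := fullrowsub_unit fM; rewrite unitmxE unitfE => dM.
exists (fullrankfun fM); rewrite -det_tr; move: dM; congr (\det _ != 0).
by apply/matrixP=> i l; rewrite !mxE.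
Qed.

Section Shift.
Variable A : idomainType.
Hypothesis fA : factorial_dom A.

Lemma prime_divides_sym (q x : A) : prime_elt q -> prime_elt x -> divides q x ->
  divides x q.
Proof.
move=> qP xP [c xE]; have [Uc|Uq] := prime_irreducible xP xE.
  by exists c^-1; rewrite xE mulKr.
by case/negP: qP.2.1.
Qed.

(** Take t to be the product of the prime factors of b that do not divide c. A prime factor of b
    that divides c then divides neither t nor g, and any other one divides t but not c. *)
Lemma coprime_shift (g b c : A) e : prime_elt g -> ~ divides g b ->
  exists t, forall q, prime_elt q -> divides q b -> divides q (c + g ^+ e.+1 * t ^+ e.+1) ->
    False.
Proof.
move=> gP gb; have b0 : b != 0 by apply: contra_not_neq gb => ->; apply: divides0.
have [u [s [Uu sP bE]]] := fA b0.
pose coc x := if excluded_middle_informative (divides x c) then false else true.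
exists (\prod_(x <- s | coc x) x) => q qP; rewrite {1}bE => qb.
have [x xs qx] : exists2 x, x \in s & divides q x.
  apply: (prime_prod qP.2); case: (qP.2.2 _ _ qb) => //.
  by move/(divides_unitE Uu); rewrite (negPf qP.2.1).
have xq := prime_divides_sym qP (sP x xs) qx.
have [qc|qc] := classic (divides q c).
  move/(dividesDr qc)/(qP.2.2 _ _) => [] /(prime_ideal_exp qP.2).
    move=> /(prime_divides_sym qP gP) gq; apply: gb; apply: divides_trans gq _.
    by rewrite bE.
  rewrite -big_filter => /(prime_prod qP.2)[y]; rewrite mem_filter /coc => /andP[].
  case: excluded_middle_informative => // yc _ ys qy; apply: yc.
  exact: divides_trans (prime_divides_sym qP (sP y ys) qy) qc.
have cx : coc x.
  by rewrite /coc; case: excluded_middle_informative => // xc; case: qc; apply: divides_trans xc.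
rewrite addrC => qgc; apply: qc; apply: dividesDr qgc; apply: divides_mull.
rewrite -big_filter (big_rem x) /=; last by rewrite mem_filter cx.
by rewrite exprMn exprS; apply/divides_mulr/divides_mulr.
Qed.

End Shift.

(** * Derivations of residue and fraction fields of A *)

Section Fractions.
Variables (K : idomainType) (n p : nat) (k : fieldType).
Local Notation A := {mpoly K[n]}.
Local Notation B := (@ppow_ring K n p).
Variable rho : {rmorphism A -> k}.
Hypothesis hp : p \in [pchar K].
Hypothesis rho_frac : forall y, exists a b, rho b != 0 /\ y * rho b = rho a.
Implicit Types (S : A -> Prop) (a b : A) (y : k).

Lemma pchar_quotient : p \in [pchar k].
Proof. exact: (rmorph_pchar rho) (pchar_mpoly n hp). Qed.

(** Denominators from B suffice: for a subring S containing B this is the whole field generated by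
    the image of S, as a / b = a b^(p-1) / b^p. *)
Definition fracs S y : Prop :=
  exists a b, [/\ S a, B b, rho b != 0 & y * rho b = rho a].

Lemma fracs_rho S a : S a -> fracs S (rho a).
Proof.
move=> Sa; exists a, 1; rewrite rmorph1 mulr1 oner_neq0; split=> //.
exact: subring1 (@ppow_subring K n p).
Qed.

Section OverB.
Variable S : A -> Prop.
Hypotheses (hS : subring S) (BS : forall b, B b -> S b).

Lemma fracs_subring : subring (fracs S).
Proof.
have hB := @ppow_subring K n p; split.
- by rewrite -(rmorph1 rho); apply/fracs_rho/(subring1 hS).
- move=> y z [a [b [Sa Bb b0 yE]]] [c [d [Sc Bd d0 zE]]].
  exists (a * d - c * b), (b * d); rewrite rmorphM mulf_neq0 //; split=> //.
  + by apply: subringB => //; apply: subringM => //; apply: BS.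
  + exact: subringM.
  + by rewrite rmorphB !rmorphM -yE -zE; ring.
- move=> y z [a [b [Sa Bb b0 yE]]] [c [d [Sc Bd d0 zE]]].
  exists (a * c), (b * d); rewrite rmorphM mulf_neq0 //; split=> //.
  + exact: subringM.
  + exact: subringM.
  + by rewrite rmorphM -yE -zE; ring.
Qed.

Lemma fracs_exp y : fracs S (y ^+ p).
Proof.
have [a [b [b0 yE]]] := rho_frac y; exists (a ^+ p), (b ^+ p).
split; [exact/BS/(ppow_exp hp) | exact: ppow_exp hp _ | by rewrite rmorphXn expf_neq0 |].
by rewrite !rmorphXn -yE exprMn.
Qed.

End OverB.

(** A derivation that vanishes on the image of K is determined on A by its values v l at the
    variables, through the chain rule. *)
Lemma dual_graph_mderiv (T : {poly k} -> Prop) (v : 'I_n -> k) :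
    dual_graph p T -> (forall c, T (rho c%:MP)%:P) ->
    (forall l, exists P, [/\ T P, P`_0 = rho 'X_l & P`_1 = v l]) ->
  forall a, exists P, [/\ T P, P`_0 = rho a & P`_1 = \sum_l rho (mderiv l a) * v l].
Proof.
case=> hT _ _ _ TC TX; elim/mpoly_ring_ind.
- move=> c; exists (rho c%:MP)%:P; rewrite !coefC; split=> //.
  by rewrite big1 // => l _; rewrite mderivC rmorph0 mul0r.
- move=> i; have [P [TP P0 P1]] := TX i; exists P; split=> //.
  have DX : mderiv i ('X_i : A) = 1.
    rewrite mderivX mnm1E eqxx scale1r -mpolyX0; congr ('X_[_]).
    by apply/mnmP=> j; rewrite mnmBE subnn mnm0E.
  rewrite (bigD1 i) //= DX rmorph1 mul1r big1 ?addr0 // => l li.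
  by rewrite mderivX mnm1E eq_sym (negPf li) scale0r rmorph0 mul0r.
- move=> a b [P [TP P0 P1]] [Q [TQ Q0 Q1]]; exists (P + Q).
  rewrite !coefD P0 Q0 P1 Q1 rmorphD -big_split; split=> //; first exact: subringD.
  by apply: eq_bigr => l _; rewrite mderivD rmorphD mulrDl.
- move=> a b [P [TP P0 P1]] [Q [TQ Q0 Q1]]; exists (P * Q).
  rewrite coef0M coef1M P0 Q0 P1 Q1 rmorphM mulr_suml mulr_sumr -big_split.
  split=> //; first exact: subringM.
  by apply: eq_bigr => l _; rewrite mderivM rmorphD !rmorphM /=; ring.
Qed.

Lemma dual_dom_vector (T : {poly k} -> Prop) :
    (forall x, x \in [seq rho 'X_l | l <- enum 'I_n] -> dual_dom T x) ->
  exists v : 'I_n -> k, forall l, exists P, [/\ T P, P`_0 = rho 'X_l & P`_1 = v l].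
Proof.
move=> TX; have {}TX l : exists P, T P /\ P`_0 = rho 'X_l.
  by have [|P TP P0] := TX (rho 'X_l); [apply: map_f; rewrite mem_enum | exists P].
exists (fun l => (proj1_sig (constructive_indefinite_description _ (TX l)))`_1) => l.
by case: constructive_indefinite_description => P [TP P0] /=; exists P.
Qed.

(** The vector lists the values at the variables of a derivation of k that vanishes on the field
    generated by S and sends z to 1. *)
Lemma separating_vector S z : subring S -> (forall b, B b -> S b) ->
    ~ fracs S (rho z) ->
  exists v : 'I_n -> k,
    (forall a, fracs S (rho a) -> \sum_l rho (mderiv l a) * v l = 0) /\
    \sum_l rho (mderiv l z) * v l = 1.
Proof.
move=> hS BS nz; have hk := pchar_quotient.
have hF := fracs_subring hS BS; have Fp := fracs_exp BS.
have [T [hT cT Tz /dual_dom_vector[v vP]]] :=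
  dual_graph_separating hk hF Fp [seq rho 'X_l | l <- enum 'I_n] nz.
have Fc y : fracs S y -> T y%:P by move=> Fy; apply: cT; rewrite /dual_const !coefC.
have TC c : T (rho c%:MP)%:P.
  by apply/Fc/fracs_rho/BS; apply: adjoin_base; exists c.
have TD := dual_graph_mderiv hT TC vP; have [hT1 _ _ T0] := hT.
exists v; split=> [a /Fc Ta|].
  have [P [TP P0 <-]] := TD a; have := T0 (P - (rho a)%:P).
  rewrite !coefB !coefC P0 subrr subr0; apply=> //; exact: subringB.
have [P [TP P0 <-]] := TD z; have := T0 (P - dualX (rho z) 1).
rewrite !coefB dualX_coef0 dualX_coef1 P0 subrr => Pz.
by apply/eqP; rewrite -subr_eq0; apply/eqP/Pz => //; apply: subringB.
Qed.

(** The powers 'X_i^(p j) are pairwise distinct elements of B, even when K is finite. *)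
Lemma fracs_infinite S : (0 < n)%N -> (forall b, B b -> S b) ->
    (forall a, rho a = 0 -> a = 0) ->
  forall s : seq k, exists2 w, fracs S w & w \notin s.
Proof.
move=> n0 BS rho_inj s; pose i := Ordinal n0.
pose ws := [seq rho ('X_i ^+ (p * j)) | j <- iota 0 (size s).+1].
have p0 := prime_gt0 (pcharf_prime hp).
have ws_uniq : uniq ws.
  rewrite map_inj_uniq ?iota_uniq // => a b ab.
  have /eqP : rho ('X_i ^+ (p * a) - 'X_i ^+ (p * b)) = 0 by rewrite rmorphB ab subrr.
  move/eqP/rho_inj/eqP; rewrite subr_eq0 => /eqP/(congr1 (fun q : A => msize q)).
  rewrite !mpolyXn !msizeX !mdegMn mdeg1 !mul1n => -[/eqP].
  by rewrite eqn_pmul2l // => /eqP.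
have [w wws ws'] : exists2 w, w \in ws & w \notin s.
  apply: NNPP => nw; suff /(uniq_leq_size ws_uniq) : {subset ws <= s}.
    by rewrite size_map size_iota ltnn.
  by move=> w wws; apply/negPn/negP => ws'; apply: nw; exists w.
exists w => //; case/mapP: wws => j _ ->; apply/fracs_rho/BS.
rewrite exprM; apply: (subringX (@ppow_subring K n p)).
by apply: adjoin_gen; exists i.
Qed.

(** The derivation comes from [dual_graph_eigen]: a constant is an eigenvector for 0, an eigenvalue
    that occurs only on the field generated by S. *)
Lemma derivation_with_constants S : (0 < n)%N -> subring S ->
    (forall b, B b -> S b) -> (forall a, rho a = 0 -> a = 0) ->
  exists v : 'I_n -> A, forall a,
    \sum_l v l * mderiv l a = 0 <-> fracs S (rho a).
Proof.
move=> n0 hS BS rho_inj; have hk := pchar_quotient.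
have hF := fracs_subring hS BS; have Fp := fracs_exp BS.
have [T [hT cT /dual_dom_vector[v vP] [L [_ TL]]]] :=
  dual_graph_eigen hk hF Fp [seq rho 'X_l | l <- enum 'I_n]
    (fracs_infinite n0 BS rho_inj).
have Fc y : fracs S y -> T y%:P by move=> Fy; apply: cT; rewrite /dual_const !coefC.
have TC c : T (rho c%:MP)%:P.
  by apply/Fc/fracs_rho/BS; apply: adjoin_base; exists c.
have TD := dual_graph_mderiv hT TC vP; have [hT1 _ _ T0] := hT.
(* A common denominator d of the values v l; multiplying the derivation by it leaves the kernel
   unchanged and makes it map A to A. *)
have [d [d0 [w wE]]] : exists d, rho d != 0 /\
    exists w : 'I_n -> A, forall l, rho (w l) = v l * rho d.
  have vE l : exists a b, rho b != 0 /\ v l * rho b = rho a by apply: rho_frac.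
  pose num l := proj1_sig (constructive_indefinite_description _ (vE l)).
  have numP l : exists b, rho b != 0 /\ v l * rho b = rho (num l).
    by rewrite /num; case: constructive_indefinite_description.
  pose den l := proj1_sig (constructive_indefinite_description _ (numP l)).
  have denP l : rho (den l) != 0 /\ v l * rho (den l) = rho (num l).
    by rewrite /den; case: constructive_indefinite_description.
  exists (\prod_l den l); split.
    by rewrite rmorph_prod; apply/prodf_neq0 => l _; case: (denP l).
  exists (fun l => num l * \prod_(l' | l' != l) den l') => l.
  by rewrite [in RHS](bigD1 l) //= !rmorphM mulrA; case: (denP l) => _ ->.
exists w => a; have [P [TP P0 P1]] := TD a.
have DE : rho (\sum_l w l * mderiv l a) = rho d * P`_1.
  rewrite rmorph_sum P1 mulr_sumr; apply: eq_bigr => l _.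
  by rewrite rmorphM wE; ring.
split=> [Da|/Fc Ta].
  have P10 : P`_1 = 0.
    by apply: (mulfI d0); rewrite -DE Da rmorph0 mulr0.
  have [a0|a0] := eqVneq (rho a) 0; first by rewrite a0; apply: subring0.
  have [] := TL P 0 TP; [exact: subring0|by rewrite P0|by rewrite mul0r|].
  by move=> _; rewrite P0; apply.
apply: rho_inj; rewrite DE (_ : P`_1 = 0) ?mulr0 //.
have := T0 (P - (rho a)%:P); rewrite !coefB !coefC P0 subrr subr0; apply=> //.
exact: subringB.
Qed.

End Fractions.

(** * From Jacobians to p-bases *)

Section Generated.
Variables (K : idomainType) (n p m : nat) (f : 'I_m -> {mpoly K[n]}).
Hypothesis hp : p \in [pchar K].
Local Notation A := {mpoly K[n]}.
Local Notation B := (@ppow_ring K n p).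
Implicit Types (P : pred 'I_m) (a b c : A).

(** For P k := (k != i) this is convertible to [R1 p f i]. *)
Definition gens P : A -> Prop := adjoin B (fun a => exists k, P k /\ a = f k).

Definition fpow (alpha : {ffun 'I_m -> 'I_p}) : A := \prod_(i < m) f i ^+ alpha i.

Lemma gens_subring P : subring (gens P).
Proof. exact: adjoin_subring. Qed.

Lemma gens_base P b : B b -> gens P b.
Proof. exact: adjoin_base. Qed.

Lemma gens_gen P k : P k -> gens P (f k).
Proof. by move=> Pk; apply: adjoin_gen; exists k. Qed.

Lemma gens_mono P Q : {subset P <= Q} -> forall a, gens P a -> gens Q a.
Proof. by move=> PQ; apply: adjoin_mono => a [k [/PQ Qk ->]]; exists k. Qed.

Lemma R2_gens i j a : R2 p f i j a <-> gens (fun k => (k != i) && (k != j)) a.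
Proof.
split; apply: adjoin_mono => x [k].
  by case=> ki kj ->; exists k; rewrite ki kj.
by case=> /andP[ki kj] ->; exists k.
Qed.

Lemma gens_pow P i a : gens P a -> exists t : nat -> A,
  (forall e, gens (fun k => P k && (k != i)) (t e)) /\ a = \sum_(e < p) t e * f i ^+ e.
Proof.
have hS := gens_subring (fun k => P k && (k != i)).
move=> Pa; apply: (adjoin_pow hS (prime_gt0 (pcharf_prime hp))).
  by apply: gens_base; apply: ppow_exp.
move: a Pa; apply: adjoin_min; first exact: adjoin_subring.
  by move=> b Bb; apply/adjoin_base/gens_base.
move=> _ [k [Pk ->]]; have [->|ki] := eqVneq k i; first exact: adjoin_gen.
by apply/adjoin_base/gens_gen; rewrite Pk ki.
Qed.

(* Exponents are reduced modulo p, since f_i^p lies in B. *)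
Lemma gens_span P a : gens P a -> exists c : {ffun 'I_m -> 'I_p} -> A,
  [/\ forall alpha, B (c alpha),
      forall (alpha : {ffun 'I_m -> 'I_p}) k, ~~ P k -> alpha k != 0%N :> nat -> c alpha = 0
    & a = \sum_alpha c alpha * fpow alpha].
Proof.
have hB := @ppow_subring K n p; have p0 := prime_gt0 (pcharf_prime hp).
pose V a := exists c : {ffun 'I_m -> 'I_p} -> A,
  [/\ forall alpha, B (c alpha),
      forall (alpha : {ffun 'I_m -> 'I_p}) k, ~~ P k -> alpha k != 0%N :> nat -> c alpha = 0
    & a = \sum_alpha c alpha * fpow alpha].
have VB x y : V x -> V y -> V (x - y).
  case=> c [Bc Pc ->] [d [Bd Pd ->]]; exists (fun alpha => c alpha - d alpha); split.
  - by move=> alpha; apply: subringB.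
  - by move=> alpha k Pk ak; rewrite (Pc _ k) // (Pd _ k) // subrr.
  - by rewrite -sumrB; apply: eq_bigr => alpha _; rewrite mulrBl.
have V0 : V 0.
  exists (fun _ => 0); split=> //; first by move=> _; apply: subring0.
  by rewrite big1 // => alpha _; rewrite mul0r.
have VD x y : V x -> V y -> V (x + y).
  by move=> Vx Vy; rewrite -[y]opprK; apply: (VB) => //; rewrite -sub0r; apply: (VB).
have Vpow b (e : 'I_m -> nat) : B b -> (forall k, ~~ P k -> e k = 0%N) ->
    V (b * \prod_(i < m) f i ^+ e i).
  move=> Bb Pe; pose r : {ffun 'I_m -> 'I_p} := [ffun i => Ordinal (ltn_pmod (e i) p0)].
  exists (fun alpha => if alpha == r then b * \prod_(i < m) (f i ^+ p) ^+ (e i %/ p) else 0).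
  split.
  - move=> alpha; case: ifP => _; last exact: subring0.
    apply: subringM => //; apply: subring_prod => // i _.
    by apply: subringX => //; apply: ppow_exp.
  - move=> alpha k Pk ak; case: eqP => // ar.
    by move: ak; rewrite ar ffunE /= Pe // mod0n.
  rewrite (bigD1 r) //= eqxx [X in _ + X]big1 ?addr0; last first.
    by move=> alpha /negPf->; rewrite mul0r.
  rewrite -mulrA -big_split; congr (_ * _); apply: eq_bigr => i _.
  by rewrite ffunE /= -exprM -exprD mulnC -divn_eq.
apply: (@adjoin_min _ _ _ V).
- split=> //.
    have := Vpow 1 (fun _ => 0%N) (subring1 hB) (fun _ _ => erefl).
    by rewrite mul1r big1 // => i _; rewrite expr0.
  move=> _ _ [c [Bc Pc ->]] [d [Bd Pd ->]]; rewrite mulr_suml.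
  apply: big_ind => // alpha _; rewrite mulr_sumr; apply: big_ind => // beta _.
  have -> : c alpha * fpow alpha * (d beta * fpow beta)
      = c alpha * d beta * \prod_(i < m) f i ^+ (alpha i + beta i).
    rewrite mulrACA; congr (_ * _); rewrite /fpow -big_split.
    by apply: eq_bigr => i _; rewrite exprD.
  have [[k [Pk abk]]|nk] := classic (exists k, ~~ P k /\ (alpha k + beta k)%N != 0%N).
    suff -> : c alpha * d beta = 0 by rewrite mul0r.
    have [ak|ak] := eqVneq (alpha k : nat) 0%N.
      by rewrite (Pd _ k) ?mulr0 // -lt0n; move: abk; rewrite ak add0n lt0n.
    by rewrite (Pc _ k) ?mul0r.
  apply: Vpow => [|k Pk]; first exact: subringM.
  by apply/eqP/negPn/negP => abk; apply: nk; exists k.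
- move=> b Bb; have := Vpow b (fun _ => 0%N) Bb (fun _ _ => erefl).
  by rewrite big1 ?mulr1 // => i _; rewrite expr0.
move=> _ [k [Pk ->]]; have := Vpow 1 (fun i => (i == k) : nat) (subring1 hB).
rewrite mul1r (bigD1 k) //= eqxx expr1 big1 ?mulr1 => [|i /negPf-> //].
by apply=> i; case: eqP => // ->; rewrite Pk.
Qed.

(** Chain rule: the gamma k are the partial derivatives, with respect to the f k, of an expression
    for a over B. *)
Lemma gens_mderiv P a : gens P a -> exists gamma : 'I_m -> A,
  (forall k, ~~ P k -> gamma k = 0) /\
  forall l, mderiv l a = \sum_k gamma k * mderiv l (f k).
Proof.
elim=> {a} [b Bb|_ [k [Pk ->]]||a b _ [c [Pc aE]] _ [d [Pd bE]]
    |a b _ [c [Pc aE]] _ [d [Pd bE]]].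
- exists (fun _ => 0); split=> // l; rewrite (ppowP hp b).1 // big1 // => i _.
  by rewrite mul0r.
- exists (fun i => (i == k)%:R); split=> [i|l].
    by case: eqP => // ->; rewrite Pk.
  by rewrite (bigD1 k) //= eqxx mul1r big1 ?addr0 // => i /negPf->; rewrite mul0r.
- exists (fun _ => 0); split=> // l; rewrite -mpolyC1 mderivC big1 // => i _.
  by rewrite mul0r.
- exists (fun k => c k - d k); split=> [k Pk|l]; first by rewrite Pc // Pd // subrr.
  by rewrite mderivB aE bE -sumrB; apply: eq_bigr => k _; rewrite mulrBl.
- exists (fun k => c k * b + a * d k); split=> [k Pk|l].
    by rewrite Pc // Pd // mul0r mulr0 addr0.
  rewrite mderivM aE bE mulr_suml mulr_sumr -big_split; apply: eq_bigr => k _ /=; ring.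
Qed.

(** Cramer's rule: multiplying the row of sums by the adjugate of the Jacobian matrix isolates each
    gamma i times the determinant. *)
Lemma divides_jac N (gamma : 'I_m -> A) :
    (forall l, divides N (\sum_k gamma k * mderiv l (f k))) ->
  forall j i, divides N (gamma i * jac f j).
Proof.
move=> Ng j i; rewrite /jac; set M := \matrix_(_, _) _.
have : (\row_k gamma k) *m M *m \adj M = (\row_k gamma k) *m (\det M)%:M.
  by rewrite -mulmxA mul_mx_adj.
move/matrixP/(_ 0 i); rewrite mul_mx_scalar mxE [RHS]mxE mxE mulrC => <-.
apply: divides_sum => l _; apply: divides_mulr; rewrite mxE.
by under eq_bigr => k _ do rewrite !mxE.
Qed.

End Generated.

Lemma divides_mulrn (A : idomainType) p (N a : A) e : p \in [pchar A] ->
  (0 < e < p)%N -> divides N (a *+ e) -> divides N a.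
Proof.
move=> pA /andP[e0 ep] Na; have pP := pcharf_prime pA.
have /coprimeP : coprime e p by rewrite coprime_sym prime_coprime // gtnNdvd.
case/(_ e0) => -[u v] /= uv.
have uvE : (u * e = v * p + 1)%N by move: uv; lia.
have -> : a = (a *+ e) *+ u.
  rewrite -mulrnA mulnC uvE mulrnDr mulr1n mulnC mulrnA.
  by rewrite -[a *+ p]mulr_natr (pcharf0 pA) mulr0 mul0rn add0r.
by rewrite -mulr_natr; apply: divides_mulr.
Qed.

Section JacobianToBasis.
Variables (K : idomainType) (n p m : nat) (f : 'I_m -> {mpoly K[n]}).
Hypothesis hp : p \in [pchar K].
Hypothesis fA : factorial_dom {mpoly K[n]}.
Hypothesis n_gt0 : (0 < n)%N.
Local Notation A := {mpoly K[n]}.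
Local Notation B := (@ppow_ring K n p).
Hypothesis exA : exists q : A, prime_elt q.
Hypothesis jac1 : forall q : A, prime_elt q ->
  exists2 a, exists j, a = jac f j & ~ divides q a.

(** N divides gamma i times every Jacobian, and no prime divides all Jacobians. *)
Lemma divides_gamma N (gamma : 'I_m -> A) :
    (forall l, divides N (\sum_k gamma k * mderiv l (f k))) ->
  forall i, divides N (gamma i).
Proof.
move=> Ng i; apply: (divides_coprime fA jac1).
  by move=> _ [j ->]; apply: divides_jac.
have [q /jac1[a ja qa]] := exA; exists a => //.
by apply: contra_not_neq qa => ->; apply: divides0.
Qed.

Lemma mderiv_meval_mono l (e : 'X_{1..m}) :
  mderiv l ('X_[A, e].@[f]) = \sum_i (mderiv i 'X_[A, e]).@[f] * mderiv l (f i).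
Proof.
pose P (q : {mpoly A[m]}) := mderiv l (q.@[f]) = \sum_i (mderiv i q).@[f] * mderiv l (f i).
have PM q r : P q -> P r -> P (q * r).
  rewrite /P mevalM mderivM => -> ->; rewrite mulr_suml mulr_sumr -big_split.
  by apply: eq_bigr => i _ /=; rewrite mderivM mevalD !mevalM mulrDl [in RHS]mulrAC mulrA.
have P1 : P 1.
  rewrite /P meval1 -mpolyC1 mderivC big1 // => i _.
  by rewrite -mpolyC1 mderivC meval0 mul0r.
have PX i : P 'X_i.
  rewrite /P mevalXU (bigD1 i) //= [X in _ + X]big1 => [|j ji].
    rewrite mderivX mnm1E eqxx scale1r mevalX big1 ?mul1r ?addr0 // => j _.
    by rewrite mnmBE subnn expr0.
  by rewrite mderivX mnm1E eq_sym (negPf ji) scale0r meval0 mul0r.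
suff : P 'X_[A, e] by [].
rewrite mpolyXE_id; apply: (big_ind P P1 PM) => i _.
elim: (e i) => [|d IHd]; first by rewrite expr0.
by rewrite exprS; apply: PM (PX i) IHd.
Qed.

Lemma mderiv_meval l (q : {mpoly A[m]}) : (forall e, B q@_e) ->
  mderiv l (q.@[f]) = \sum_i (mderiv i q).@[f] * mderiv l (f i).
Proof.
move=> Bq.
have dqE i : (mderiv i q).@[f] = \sum_(e <- msupp q) q@_e * (mderiv i 'X_[A, e]).@[f].
  rewrite {1}[q]mpolyE (raddf_sum (mderiv i)) (raddf_sum (meval f)); apply: eq_bigr => e _.
  by rewrite /= mderivZ mevalZ.
under eq_bigr => i _ do rewrite dqE mulr_suml.
rewrite exchange_big {1}[q]mpolyE (raddf_sum (meval f)) (raddf_sum (mderiv l)); apply: eq_bigr => e _ /=.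
rewrite mevalZ mderivM (ppowP hp _).1 // mul0r add0r mderiv_meval_mono mulr_sumr.
by apply: eq_bigr => i _; rewrite mulrA.
Qed.

(* For N = 0 this is the linear independence over B of the reduced monomials in f. *)
Lemma divides_meval N (q : {mpoly A[m]}) : B N -> (forall e, B q@_e) ->
    (forall e, q@_e != 0 -> forall i, (e i < p)%N) ->
  divides N (q.@[f]) -> forall e, divides N q@_e.
Proof.
move=> BN; have [s] := ubnP (msize q); elim: s q => // s IHs q qs Bq qp Nq.
(* Such a coefficient survives in the i-th derivative of q, multiplied by e i, which is prime to p;
   the derivative falls under the induction hypothesis. *)
have pos (e : 'X_{1..m}) i : (0 < e i)%N -> divides N q@_e.
  move=> ei; have [->|qe] := eqVneq q@_e 0; first exact: divides0.
  have eE : ((e - U_(i)) + U_(i))%MM = e.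
    by rewrite submK //; apply/mnm_lepP=> j; rewrite mnm1E; case: eqP => // <-.
  have eiE : (e - U_(i))%MM i = (e i).-1 by rewrite mnmBE mnm1E eqxx subn1.
  have [dq0|dq0] := eqVneq (mderiv i q) 0.
    have := mcoeff_deriv i (e - U_(i))%MM q; rewrite dq0 mcoeff0 eE eiE prednK // => q0.
    apply: (@divides_mulrn _ p _ _ (e i) (pchar_mpoly n hp)).
      by rewrite ei qp.
    by rewrite -q0; apply: divides0.
  apply: (@divides_mulrn _ p _ _ (e i) (pchar_mpoly n hp)); first by rewrite ei qp.
  have <- : (mderiv i q)@_(e - U_(i)) = q@_e *+ e i by rewrite mcoeff_deriv eE eiE prednK.
  apply: IHs => [|d|d|].
  - exact: leq_trans (msize_mderiv dq0) qs.
  - by rewrite mcoeff_deriv; apply: (subringMn (@ppow_subring K n p)).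
  - rewrite mcoeff_deriv => qd j; apply: leq_ltn_trans (qp (d + U_(i))%MM _ j).
      by rewrite mnmDE leq_addr.
    by apply: contraNneq qd => ->; rewrite mul0rn.
  (* The derivatives of N vanish, so N divides every derivative of q(f) = c N, which the chain rule
     expands. *)
  apply: (@divides_gamma N (fun i => (mderiv i q).@[f])) => l.
  rewrite -mderiv_meval //; case: Nq => c ->.
  by exists (mderiv l c); rewrite mderivM (ppowP hp N).1 // mulr0 addr0.
move=> e; have [[i ei]|ne] := classic (exists i, (0 < e i)%N); first exact: pos ei.
have -> : e = 0%MM.
  apply/mnmP=> i; rewrite mnm0E; apply/eqP; rewrite -leqn0 leqNgt.
  by apply/negP => ei; apply: ne; exists i.
(* All other terms are already divisible by N; subtracting them leaves the constant coefficient. *)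
suff : divides N ((q - (q@_0)%:MP).@[f]).
  by move/(dividesB Nq); rewrite mevalB mevalC opprB addrC subrK.
rewrite mevalE; apply: divides_sum => d _; apply: divides_mulr.
rewrite mcoeffB mcoeffC; have [->|d0] := eqVneq d 0%MM.
  by rewrite mulr1 subrr; apply: divides0.
rewrite mulr0 subr0; have [i di] : exists i, (0 < d i)%N.
  apply: NNPP => nd; case/eqP: d0; apply/mnmP=> i; rewrite mnm0E; apply/eqP.
  by rewrite -leqn0 leqNgt; apply/negP => di; apply: nd; exists i.
exact: pos di.
Qed.

Lemma divides_fpow_sum N (c : {ffun 'I_m -> 'I_p} -> A) : B N ->
    (forall alpha, B (c alpha)) -> divides N (\sum_alpha c alpha * fpow f alpha) ->
  forall alpha, divides N (c alpha).
Proof.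
move=> BN Bc Nc alpha.
pose mon (al : {ffun 'I_m -> 'I_p}) : 'X_{1..m} := [multinom (al i : nat) | i < m].
have mon_inj : injective mon.
  move=> al be /mnmP e; apply/ffunP=> i; apply: val_inj.
  by have := e i; rewrite !mnmE.
pose q : {mpoly A[m]} := \sum_al c al *: 'X_[mon al].
have qE e : q@_e = \sum_al c al * (mon al == e)%:R.
  by rewrite raddf_sum /=; apply: eq_bigr => al _; rewrite mcoeffZ mcoeffX.
have -> : c alpha = q@_(mon alpha).
  rewrite qE (bigD1 alpha) //= eqxx mulr1 big1 ?addr0 // => al ne.
  by rewrite (inj_eq mon_inj) (negPf ne) mulr0.
apply: divides_meval => // [e|e|].
- rewrite qE; apply: (subring_sum (@ppow_subring K n p)) => al _.
  apply: (subringM (@ppow_subring K n p)) => //.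
  exact: subring_nat (@ppow_subring K n p) _.
- rewrite qE => e0 i; have [[al alE]|nal] := classic (exists al, mon al = e).
    by rewrite -alE mnmE.
  case/eqP: e0; apply: big1 => al _; case: eqP => [alE|_]; last by rewrite mulr0.
  by case: nal; exists al.
rewrite (_ : q.@[f] = \sum_al c al * fpow f al) // raddf_sum /=.
apply: eq_bigr => al _; rewrite mevalZ mevalX; congr (_ * _).
by apply: eq_bigr => i _; rewrite mnmE.
Qed.

(** In the fraction field of A, take a derivation whose constants form the field generated by B[f].
    A constant of A is then an element of B[f] divided by some N in B, and [divides_fpow_sum]
    divides its coefficients by N. *)
Lemma jac1_p_basis : exists d : {linear A -> A},
  is_derivation d /\ is_p_basis p B (constants d) f.
Proof.
have [k [rho [rho0 rho_frac]]] := prime_quotient_field (prime_ideal0 A).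
have rho_inj a : rho a = 0 -> a = 0 by case/rho0 => c ->; rewrite mulr0.
have [v vP] := derivation_with_constants hp rho_frac n_gt0
  (gens_subring p f predT) (fun b => @gens_base _ _ p _ f predT b) rho_inj.
have d_linear : linear (fun a : A => \sum_l v l * mderiv l a).
  move=> c a b; rewrite scaler_sumr -big_split; apply: eq_bigr => l _ /=.
  by rewrite mderivD mderivZ mulrDr scalerAr.
pose dL := GRing.isLinear.Build K A A _ (fun a : A => \sum_l v l * mderiv l a) d_linear.
pose d : {linear A -> A} := HB.pack (fun a : A => \sum_l v l * mderiv l a) dL.
exists d; split.
  move=> a b; rewrite /d /= mulr_suml mulr_sumr -big_split.
  by apply: eq_bigr => l _ /=; rewrite mderivM; ring.
have constE a : constants d a <-> fracs p rho (gens p f predT) (rho a) by apply: vP.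
split.
- move=> alpha; apply/constE/fracs_rho.
  apply: (subring_prod (gens_subring p f predT)) => i _.
  apply: (subringX (gens_subring p f predT)); exact: gens_gen.
- move=> a /constE[a1 [N [/(gens_span hp)[c [Bc _ a1E]] BN N0 aE]]].
  have aN : a * N = \sum_al c al * fpow f al.
    rewrite -a1E; apply/eqP; rewrite -subr_eq0; apply/eqP/rho_inj.
    by rewrite rmorphB rmorphM aE subrr.
  have Nn0 : N != 0 by apply: contraNneq N0 => ->; rewrite rmorph0.
  have cN al : divides N (c al).
    by apply: divides_fpow_sum => //; exists a.
  pose c' al := proj1_sig (constructive_indefinite_description _ (cN al)).
  have c'E al : c al = c' al * N.
    by rewrite /c'; case: constructive_indefinite_description.
  exists c'; split=> [al|].
    apply/(ppowP hp)=> l; apply: (mulIf Nn0); rewrite mul0r.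
    have := (ppowP hp (c al)).1 (Bc al) l.
    by rewrite c'E mderivM (ppowP hp N).1 // mulr0 addr0.
  apply: (mulIf Nn0); rewrite aN mulr_suml; apply: eq_bigr => al _.
  by rewrite c'E /fpow; ring.
- move=> c Bc c0 al.
  have c0' : divides 0 (\sum_al c al * fpow f al) by rewrite [X in divides _ X]c0; apply: divides0.
  have [e ->] := divides_fpow_sum (subring0 (@ppow_subring K n p)) Bc c0' al.
  by rewrite mulr0.
Qed.

End JacobianToBasis.

(** * From p-bases to divisibility *)

Section BasisToGcd.
Variables (K : idomainType) (n p m : nat) (f : 'I_m -> {mpoly K[n]}).
Hypothesis hp : p \in [pchar K].
Hypothesis fA : factorial_dom {mpoly K[n]}.
Local Notation A := {mpoly K[n]}.
Local Notation B := (@ppow_ring K n p).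
Local Notation gens := (gens p f).
Hypothesis exA : exists q : A, prime_elt q.
Variable d : {linear A -> A}.
Hypothesis d_der : is_derivation d.
Hypothesis d_basis : is_p_basis p B (constants d) f.
Implicit Types (a b c g : A).

Let p_gt0 : (0 < p)%N := prime_gt0 (pcharf_prime hp).
Let p_gt1 : (1 < p)%N := prime_gt1 (pcharf_prime hp).

Lemma derivation1 : d 1 = 0.
Proof.
have := d_der 1 1; rewrite !mulr1 mul1r => /eqP.
by rewrite -subr_eq0 opprD addNKr oppr_eq0 => /eqP.
Qed.

Lemma constants_subring : subring (constants d).
Proof.
split; first exact: derivation1.
  by move=> a b da db; rewrite /constants linearB /= da db subrr.
by move=> a b da db; rewrite /constants d_der da db mul0r mulr0 addr0.
Qed.

Lemma derivation_exp a e : d (a ^+ e) = (a ^+ e.-1 * d a) *+ e.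
Proof.
elim: e => [|e IHe]; first by rewrite expr0 derivation1 mulr0n.
rewrite exprS d_der IHe mulrS mulrC /=; congr (_ + _).
by case: e {IHe} => [|e]; rewrite ?mulr0n ?mulr0 // mulrnAr mulrA -exprS.
Qed.

Lemma ppow_constants b : B b -> constants d b.
Proof.
apply: (adjoin_min constants_subring) => [_ [c ->]|_ [i ->]].
  by rewrite /constants -alg_mpolyC linearZ /= derivation1 scaler0.
by rewrite /constants derivation_exp -mulr_natr (pcharf0 (pchar_mpoly n hp)) mulr0.
Qed.

Let unit_exp (i : 'I_m) : {ffun 'I_m -> 'I_p} :=
  [ffun k => if k == i then Ordinal p_gt1 else Ordinal p_gt0].

Let fpow_unit i : fpow f (unit_exp i) = f i.
Proof.
rewrite /fpow (bigD1 i) //= ffunE eqxx expr1 big1 ?mulr1 // => k /negPf ki.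
by rewrite ffunE ki expr0.
Qed.

Lemma f_constants i : constants d (f i).
Proof. by rewrite -fpow_unit; case: d_basis => + _ _; apply. Qed.

Lemma gens_constants P a : gens P a -> constants d a.
Proof.
apply: (adjoin_min constants_subring); first exact: ppow_constants.
by move=> _ [k [_ ->]]; apply: f_constants.
Qed.

Lemma constants_gens a : constants d a -> gens predT a.
Proof.
case: d_basis => _ span _ /span[c [Bc ->]].
apply: (subring_sum (gens_subring p f predT)) => al _.
apply: (subringM (gens_subring p f predT)); first exact/gens_base/Bc.
apply: (subring_prod (gens_subring p f predT)) => i _.
by apply: (subringX (gens_subring p f predT)); apply: gens_gen.
Qed.

(** A relation b f_i = a with a free of f_i would contradict the independence of the reduced
    monomials. *)
Lemma p_basis_notin_fracs (k : fieldType) (rho : {rmorphism A -> k}) i :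
    (forall a, rho a = 0 -> a = 0) ->
  ~ fracs p rho (gens (fun k => k != i)) (rho (f i)).
Proof.
move=> rho_inj [a [b [/(gens_span hp)[c [Bc ci aE]] Bb b0 fb]]].
have E : \sum_al ((if al == unit_exp i then b else 0) - c al) * fpow f al = 0.
  under eq_bigr => al _ do rewrite mulrBl.
  rewrite sumrB -aE (bigD1 (unit_exp i)) //= eqxx [X in b * _ + X]big1 ?addr0.
    by apply: rho_inj; rewrite rmorphB fpow_unit rmorphM mulrC fb subrr.
  by move=> al /negPf->; rewrite mul0r.
have hB := @ppow_subring K n p.
case: d_basis => _ _ /(_ _ _ E (unit_exp i)); rewrite eqxx (ci _ i) ?eqxx //; last first.
  by rewrite ffunE eqxx.
rewrite subr0 => b00; case/negP: b0; rewrite b00 ?rmorph0 // => al.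
by apply: (subringB hB) => //; case: ifP => // _; apply: subring0.
Qed.

(** By [power_independence], the powers of f_i below p are independent over the field generated by
    the other f_k. *)
Lemma gens_coef_inj i (s t : nat -> A) :
    (forall e, gens (fun k => k != i) (s e)) -> (forall e, gens (fun k => k != i) (t e)) ->
    \sum_(e < p) s e * f i ^+ e = \sum_(e < p) t e * f i ^+ e ->
  forall e, (e < p)%N -> s e = t e.
Proof.
move=> gs gt st e ep.
have [k [rho [rho0 rho_frac]]] := prime_quotient_field (prime_ideal0 A).
have rho_inj a : rho a = 0 -> a = 0 by case/rho0 => c ->; rewrite mulr0.
have hS := gens_subring p f (fun k => k != i).
have BS b : B b -> gens (fun k => k != i) b by apply: gens_base.
apply/eqP; rewrite -subr_eq0; apply/eqP/rho_inj.
apply: (power_independence (pchar_quotient rho hp) (fracs_subring rho hS BS)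
  (fracs_exp hp rho_frac BS) (p_basis_notin_fracs rho_inj) (a := fun e => rho (s e - t e))) ep.
  by move=> j; apply/fracs_rho/(subringB hS).
transitivity (rho (\sum_(j < p) (s j - t j) * f i ^+ j)).
  by rewrite rmorph_sum; apply: eq_bigr => j _; rewrite rmorphM rmorphXn.
under eq_bigr => j _ do rewrite mulrBl.
by rewrite sumrB st subrr rmorph0.
Qed.

Lemma constants_divide N a c : B N -> N != 0 -> constants d a -> a = c * N ->
  constants d c.
Proof.
move=> /ppow_constants dN N0 da aE; apply: (mulIf N0); rewrite mul0r.
by move: da; rewrite /constants aE d_der dN mulr0 addr0.
Qed.

Lemma two_term_sum (x b c : A) :
  \sum_(e < p) (if (e : nat) == 0%N then c else if (e : nat) == 1%N then b else 0) * x ^+ e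
  = b * x + c.
Proof.
rewrite (bigD1 (Ordinal p_gt0)) //= (bigD1 (Ordinal p_gt1)) //= expr0 expr1 mulr1.
rewrite big1 ?addr0 1?addrC // => e /andP[]; rewrite -!val_eqE /= => /negPf-> /negPf->.
by rewrite mul0r.
Qed.

(** The quotient by g^p is a constant, hence a polynomial in f_i of degree below p over the ring
    without f_i, and the coefficients of f_i^(p-1) are compared. The factor u is 1 for squares and
    the second form for pairs. *)
Lemma power_top_coef i b c u g : gens (fun k => k != i) b -> gens (fun k => k != i) c ->
    gens (fun k => k != i) u -> g != 0 ->
    divides (g ^+ p) ((b * f i + c) ^+ p.-1 * u) ->
  exists2 y, gens (fun k => k != i) y & b ^+ p.-1 * u = y * g ^+ p.
Proof.
move=> gb gc gu g0 [y yE]; have hS := gens_subring p f (fun k => k != i).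
have Bgp : B (g ^+ p) by apply: ppow_exp.
have dW : constants d ((b * f i + c) ^+ p.-1 * u).
  have hC := constants_subring.
  apply: (subringM hC); last exact: gens_constants gu.
  apply: (subringX hC); apply: (subringD hC); last exact: gens_constants gc.
  by apply: (subringM hC); [exact: gens_constants gb | exact: f_constants].
have dy := constants_divide Bgp (expf_neq0 p g0) dW yE.
have [t [gt tE]] := gens_pow hp i (constants_gens dy).
pose s e : A := b ^+ e * c ^+ (p.-1 - e) *+ 'C(p.-1, e) * u.
have gs e : gens (fun k => k != i) (s e).
  apply: (subringM hS) => //; apply: (subringMn hS).
  by apply: (subringM hS); apply: (subringX hS).
exists (t p.-1); first exact: gt.
have := @gens_coef_inj i s (fun e => t e * g ^+ p) gs _ _ p.-1.
rewrite /s subnn expr0 mulr1 binn mulr1n => -> //; last by rewrite prednK.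
  by move=> e; apply: (subringM hS); [exact: gt | exact: gens_base].
transitivity ((b * f i + c) ^+ p.-1 * u).
  rewrite addrC exprDn prednK // mulr_suml; apply: eq_bigr => e _.
  by rewrite /s exprMn !mulrnAl; congr (_ *+ _); ring.
by rewrite yE tE mulr_suml; apply: eq_bigr => e _; ring.
Qed.

Lemma coprime_prime_power g b c e : prime_elt g -> gcd_sim1 b c -> b != 0 ->
  divides g (b ^+ e) -> (divides g b -> divides g c) -> False.
Proof.
move=> gP /(gcd_sim1P fA exA) bc b0 /(prime_ideal_exp gP.2) gb gc.
exact: bc gP gb (gc gb).
Qed.

Lemma p_basis_square_free i b c : gens (fun k => k != i) b ->
    gens (fun k => k != i) c -> b != 0 -> gcd_sim1 b c -> square_free (b * f i + c).
Proof.
move=> gb gc b0 bc q Uq qW; have [g gP gq] := prime_factor0 fA exA Uq.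
have gW : divides (g ^+ 2) (b * f i + c).
  apply: divides_trans qW; case: gq => r ->; exists (r ^+ 2).
  by rewrite exprMn.
have hS := gens_subring p f (fun k => k != i).
have [|y gy] := power_top_coef gb gc (subring1 hS) gP.1.
  (* From g^2 dividing W follows g^p dividing W^(p-1), since p <= 2 (p - 1). *)
  rewrite mulr1; case: gW => w ->; rewrite exprMn -exprM.
  apply: divides_mull; exists (g ^+ (2 * p.-1 - p)); rewrite -exprD; congr (_ ^+ _).
  by move: p_gt1; lia.
rewrite mulr1 => yE; apply: (coprime_prime_power gP bc b0 (e := p.-1)).
  by rewrite yE; apply: divides_mull; rewrite -(prednK p_gt0) exprS;
    apply/divides_mulr/divides_refl.
move=> gb'; apply: (@dividesDr _ _ (b * f i)); first exact: divides_mulr.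
by case: gW => w ->; exists (w * g); rewrite -mulrA.
Qed.

(** The quotient of b f_i + c by q in B is again a constant; expanding it in powers of f_i shows
    that q divides both b and c. *)
Lemma p_basis_free i b c : gens (fun k => k != i) b ->
    gens (fun k => k != i) c -> b != 0 -> gcd_sim1 b c -> free_of B (b * f i + c).
Proof.
move=> gb gc b0 /(gcd_sim1P fA exA) bc q Bq Uq [y yE].
have hS := gens_subring p f (fun k => k != i).
have hC := constants_subring.
pose s (e : nat) : A := if e == 0%N then c else if e == 1%N then b else 0.
have gs e : gens (fun k => k != i) (s e).
  by rewrite /s; case: ifP => _ //; case: ifP => _ //; apply: subring0.
have sE := two_term_sum (f i) b c.
(* For q = 0 the form itself would vanish, and with it its coefficient b. *)
have q0 : q != 0.
  apply: contraNneq b0 => q0; rewrite q0 mulr0 in yE.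
  have := @gens_coef_inj i s (fun _ => 0) gs _ _ 1%N p_gt1.
  rewrite /s /= => -> //; first by move=> _; apply: subring0.
  by rewrite sE yE big1 // => e _; rewrite mul0r.
have dW : constants d (b * f i + c).
  apply: (subringD hC); last exact: gens_constants gc.
  by apply: (subringM hC); [exact: gens_constants gb | exact: f_constants].
have dy := constants_divide Bq q0 dW yE.
have [t [gt tE]] := gens_pow hp i (constants_gens dy).
have st := @gens_coef_inj i s (fun e => t e * q) gs _ _.
have {}st e : (e < p)%N -> s e = t e * q.
  apply: st => [j|]; first by apply: (subringM hS); [exact: gt | exact: gens_base].
  by rewrite sE yE tE mulr_suml; apply: eq_bigr => j _; ring.
have [g gP gq] := prime_factor0 fA exA Uq; apply: (bc g gP).
  by apply: divides_trans gq _; exists (t 1%N); rewrite -st.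
by apply: divides_trans gq _; exists (t 0%N); rewrite -st.
Qed.

Lemma p_basis_coprime i j b1 b2 c1 c2 : i != j ->
    let S := gens (fun k => (k != i) && (k != j)) in
    S b1 -> S b2 -> S c1 -> S c2 -> b1 != 0 -> b2 != 0 ->
    gcd_sim1 b1 c1 -> gcd_sim1 b2 c2 ->
  gcd_sim1 (b1 * f i + c1) (b2 * f j + c2).
Proof.
move=> ij S Sb1 Sb2 Sc1 Sc2 b10 b20 bc1 bc2.
apply/(gcd_sim1P fA exA) => g gP gW1 gW2.
have Si a : S a -> gens (fun k => k != i) a.
  by apply: gens_mono => k /andP[].
have Sj a : S a -> gens (fun k => k != j) a.
  by apply: gens_mono => k /andP[].
have hi := gens_subring p f (fun k => k != i).
have hj := gens_subring p f (fun k => k != j).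
have hS : subring S := gens_subring p f _.
have gW2i : gens (fun k => k != i) (b2 * f j + c2).
  apply: (subringD hi); last exact: Si.
  by apply: (subringM hi); [exact: Si | apply: gens_gen; rewrite eq_sym].
(* The second form does not involve f_i and serves as u; g^p divides the product because g divides
   both forms. *)
have [|y gy yE] := power_top_coef (Si _ Sb1) (Si _ Sc1) gW2i gP.1.
  case: gW1 => w1 ->; case: gW2 => w2 ->; exists (w1 ^+ p.-1 * w2).
  by rewrite exprMn -[in RHS](prednK p_gt0) [in RHS]exprSr; ring.
have [t [gt tE]] := gens_pow hp j gy.
pose s (e : nat) : A :=
  if e == 0%N then b1 ^+ p.-1 * c2 else if e == 1%N then b1 ^+ p.-1 * b2 else 0.
have gs e : gens (fun k => k != j) (s e).
  rewrite /s; case: ifP => _; last case: ifP => _; last exact: subring0.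
    by apply: (subringM hj); [apply: (subringX hj) |]; apply: Sj.
  by apply: (subringM hj); [apply: (subringX hj) |]; apply: Sj.
(* The coefficients of f_j are compared next, giving g^p as a divisor of b1^(p-1) b2. *)
have st := @gens_coef_inj j s (fun e => t e * g ^+ p) gs _ _ 1%N p_gt1.
have {st} bE : b1 ^+ p.-1 * b2 = t 1%N * g ^+ p.
  apply: st => [e|].
    by apply: (subringM hj); [exact: Sj (gt e) | apply/gens_base/ppow_exp].
  rewrite (two_term_sum (f j)).
  transitivity (b1 ^+ p.-1 * (b2 * f j + c2)); first by ring.
  by rewrite yE tE mulr_suml; apply: eq_bigr => e _; ring.
have : divides g (b1 ^+ p.-1 * b2).
  by rewrite bE -(prednK p_gt0) exprS; apply/divides_mull/divides_mulr/divides_refl.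
case/gP.2.2.
  move=> /(coprime_prime_power gP bc1 b10); apply => gb.
  by apply: dividesDr gW1; apply: divides_mulr.
rewrite -[b2]expr1 => /(coprime_prime_power gP bc2 b20); apply=> gb.
by apply: dividesDr gW2; apply: divides_mulr.
Qed.

End BasisToGcd.

(** * From divisibility to Jacobians *)

Section GcdToJacobian.
Variables (K : idomainType) (n p m : nat) (f : 'I_m -> {mpoly K[n]}).
Hypothesis hp : p \in [pchar K].
Hypothesis fA : factorial_dom {mpoly K[n]}.
Local Notation A := {mpoly K[n]}.
Local Notation B := (@ppow_ring K n p).
Local Notation gens := (gens p f).
Hypothesis exA : exists q : A, prime_elt q.
Implicit Types (a b c g : A).

Let p_gt0 : (0 < p)%N := prime_gt0 (pcharf_prime hp).

Section ModPrime.
Variables (g : A) (k : fieldType) (rho : {rmorphism A -> k}).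
Hypothesis gP : prime_elt g.
Hypothesis rho0 : forall a, rho a = 0 <-> divides g a.
Hypothesis rho_frac : forall y, exists a b, rho b != 0 /\ y * rho b = rho a.

Lemma rho_prime : rho g = 0.
Proof. exact/rho0/divides_refl. Qed.

(* The congruence b z + c = 0 mod g is preserved when a multiple t^p g^p of g^p is
   added to c, and t can be chosen so as to make b and c coprime. *)
Lemma fracs_linear (S : A -> Prop) z : subring S -> (forall b, B b -> S b) ->
    fracs p rho S (rho z) -> exists b c,
  [/\ B b, S c, rho b != 0, gcd_sim1 b c & divides g (b * z + c)].
Proof.
move=> hS BS [a [b [Sa Bb b0 zE]]].
have gb : ~ divides g b by move/rho0/eqP; apply/negP.
have [t tP] := coprime_shift fA (- a) p.-1 gP gb; rewrite prednK // in tP.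
exists b, (- a + g ^+ p * t ^+ p); split=> //.
- apply: (subringD hS); first exact: subringN.
  by apply: (subringM hS); apply/BS/ppow_exp.
- by apply/(gcd_sim1P fA exA) => q qP qb; apply: tP.
rewrite addrA; apply: dividesD.
  by apply/rho0; rewrite rmorphB rmorphM -zE mulrC subrr.
by apply: divides_mulr; rewrite -(prednK p_gt0) exprS; apply/divides_mulr/divides_refl.
Qed.

(** Adjoining f_j to a field that already contains it adds nothing. *)
Lemma fracs_absorb (P Q : pred 'I_m) j :
    (forall i, Q i -> i = j \/ P i) -> fracs p rho (gens P) (rho (f j)) ->
  forall y, fracs p rho (gens Q) y -> fracs p rho (gens P) y.
Proof.
move=> QP fj y [a [b [ga Bb b0 yE]]].
have hS := gens_subring p f P; have BS c : B c -> gens P c by apply: gens_base.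
have [hF1 hFB hFM] := fracs_subring rho hS BS.
have : fracs p rho (gens P) (rho a).
  move: a ga {yE}; apply: adjoin_min.
  - split; first by rewrite rmorph1.
    + by move=> u v; rewrite rmorphB; apply: hFB.
    + by move=> u v; rewrite rmorphM; apply: hFM.
  - by move=> c /BS/fracs_rho.
  by move=> _ [i [/QP[->|Pi] ->]] //; apply/fracs_rho/gens_gen.
case=> c [e [gc Be e0 cE]]; exists c, (b * e); rewrite rmorphM mulf_neq0 //.
split=> //; last by rewrite mulrA yE.
by apply: (subringM (@ppow_subring K n p)).
Qed.

Lemma divides_jac_minor :
    (forall a : 'I_m -> k, (forall l, \sum_i a i * rho (mderiv l (f i)) = 0) ->
       forall i, a i = 0) ->
  exists j, ~ divides g (jac f j).
Proof.
move=> indep; pose M := \matrix_(i < m, l < n) rho (mderiv l (f i)).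
have [a aM|j dM] := @minor_neq0 k m n M.
  apply/rowP=> i; rewrite [RHS]mxE; apply: (indep (fun i => a 0 i)) => l.
  move/matrixP/(_ 0 l): aM; rewrite [RHS]mxE => aM; rewrite -[RHS]aM mxE.
  by apply: eq_bigr => h _; rewrite [in RHS]mxE.
exists j => /rho0; apply/eqP; move: dM; rewrite /jac -det_map_mx.
by congr (\det _ != 0); apply/matrixP=> i l; rewrite !mxE.
Qed.

Hypothesis square_free_free : forall i b c,
  gens (fun h => h != i) b -> gens (fun h => h != i) c -> b != 0 -> gcd_sim1 b c ->
  square_free (b * f i + c) /\ free_of B (b * f i + c).
Hypothesis coprime_pairs : forall i j, i != j -> forall b1 b2 c1 c2,
  let S := gens (fun h => (h != i) && (h != j)) in
  S b1 -> S b2 -> S c1 -> S c2 -> b1 != 0 -> b2 != 0 ->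
  gcd_sim1 b1 c1 -> gcd_sim1 b2 c2 -> gcd_sim1 (b1 * f i + c1) (b2 * f j + c2).

Let neq0_rho b : rho b != 0 -> b != 0.
Proof. by apply: contraNneq => ->; rewrite rmorph0. Qed.

(** Once f_j is absorbed, f_i too lies in the field generated without f_i and f_j; then g divides
    two forms that should be coprime. *)
Lemma fracs_pair i j : i != j ->
  fracs p rho (gens (fun h => h != i)) (rho (f i)) ->
  ~ fracs p rho (gens (fun h => (h != i) && (h != j))) (rho (f j)).
Proof.
move=> ij fi fj; set S := gens _ in fj.
have hS : subring S := gens_subring p f _.
have BS b : B b -> S b by apply: gens_base.
have {}fi : fracs p rho S (rho (f i)).
  apply: fracs_absorb fj _ fi => h hi; have [->|hj] := eqVneq h j; first by left.
  by right; rewrite hi.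
have [b1 [c1 [Bb1 Sc1 b10 bc1 gW1]]] := fracs_linear hS BS fi.
have [b2 [c2 [Bb2 Sc2 b20 bc2 gW2]]] := fracs_linear hS BS fj.
have := coprime_pairs ij (BS _ Bb1) (BS _ Bb2) Sc1 Sc2 (neq0_rho b10) (neq0_rho b20) bc1 bc2.
by move/(gcd_sim1P fA exA)/(_ g gP gW1 gW2).
Qed.

(* If f_i lies modulo g in the field generated by the others, then
   b f_i + c = g h with h prime to g, so that modulo g the span of the df_k contains
   dg <> 0 besides the df_j, j <> i; the latter are independent modulo dg by
   [separating_vector], whose derivations kill g. *)
Lemma differentials_independent_dep i (a : 'I_m -> k) :
    fracs p rho (gens (fun h => h != i)) (rho (f i)) ->
    (forall l, \sum_j a j * rho (mderiv l (f j)) = 0) ->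
  forall j, a j = 0.
Proof.
move=> fi a0.
have hS := gens_subring p f (fun h => h != i).
have BS b : B b -> gens (fun h => h != i) b by apply: gens_base.
have [b [c [Bb gc b0 bc [h WE]]]] := fracs_linear hS BS fi.
have [sqW frW] := square_free_free (BS _ Bb) gc (neq0_rho b0) bc.
have gW : divides g (b * f i + c) by exists h.
(* Otherwise g would lie in B by [divides_mderivs], although it divides a B-free element. *)
have [l0 gl0] : exists l, rho (mderiv l g) != 0.
  apply: NNPP => nl; apply: (frW g) => //; last by case: gP => _ [].
  apply: divides_mderivs => // l; apply/rho0/eqP/negPn/negP => gl.
  by apply: nl; exists l.
(* If g divided h, then g^2 would divide the square-free b f_i + c. *)
have h0 : rho h != 0.
  apply/eqP=> /rho0[h' hE]; apply: (sqW g); first by case: gP => _ [].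
  by exists h'; rewrite WE hE; ring.
have [gamma [gamma0 cE]] := gens_mderiv hp gc.
have gamma_i : gamma i = 0 by apply: gamma0; rewrite eqxx.
have dW l : rho b * rho (mderiv l (f i)) + \sum_j rho (gamma j) * rho (mderiv l (f j))
    = rho h * rho (mderiv l g).
  have := congr1 (fun x => rho (mderiv l x)) WE.
  rewrite mderivD !mderivM (ppowP hp b).1 // mul0r add0r !rmorphD !rmorphM rho_prime.
  rewrite mulr0 add0r => <-; congr (_ + _); rewrite cE rmorph_sum.
  by apply: eq_bigr => j _; rewrite rmorphM.
(* A vector v that kills g and every f_h other than f_i and f_j, with value 1 on f_j, is applied
   both to the relation with coefficients a and to the differential of b f_i + c. *)
have aE j : j != i -> rho b * a j = a i * rho (gamma j).
  move=> ji; have ij : i != j by rewrite eq_sym.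
  have nfj := fracs_pair ij fi.
  have hS2 := gens_subring p f (fun h => (h != i) && (h != j)).
  have BS2 b' : B b' -> gens (fun h => (h != i) && (h != j)) b' by apply: gens_base.
  have [v [v0 vj]] := separating_vector hp rho_frac hS2 BS2 nfj.
  have vk h' : h' != i -> h' != j -> \sum_l rho (mderiv l (f h')) * v l = 0.
    by move=> hi hj; apply/v0/fracs_rho/gens_gen; rewrite hi hj.
  have vg : \sum_l rho (mderiv l g) * v l = 0.
    by apply: v0; rewrite rho_prime; apply/(subring0 (fracs_subring rho hS2 BS2)).
  have Dlin (e : 'I_m -> k) :
      \sum_l (\sum_q e q * rho (mderiv l (f q))) * v l
      = e i * (\sum_l rho (mderiv l (f i)) * v l) + e j.
    under eq_bigr => l _ do rewrite mulr_suml.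
    rewrite exchange_big (bigD1 i) //= (bigD1 j) //= [X in _ + (_ + X)]big1 => [|q].
      rewrite addr0; congr (_ + _).
        by rewrite mulr_sumr; apply: eq_bigr => l _; rewrite mulrA.
      rewrite -[RHS]mulr1 -vj mulr_sumr.
      by apply: eq_bigr => l _; rewrite mulrA.
    case/andP=> qi qj; transitivity (e q * \sum_l rho (mderiv l (f q)) * v l).
      by rewrite mulr_sumr; apply: eq_bigr => l _; rewrite mulrA.
    by rewrite vk // mulr0.
  have E1 : a i * (\sum_l rho (mderiv l (f i)) * v l) + a j = 0.
    by rewrite -Dlin big1 // => l _; rewrite a0 mul0r.
  have E2 : rho b * (\sum_l rho (mderiv l (f i)) * v l) + rho (gamma j) = 0.
    transitivity (\sum_l (rho h * rho (mderiv l g)) * v l).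
      under [RHS]eq_bigr => l _ do rewrite -dW mulrDl.
      rewrite big_split /= Dlin gamma_i rmorph0 mul0r add0r mulr_sumr.
      by congr (_ + _); apply: eq_bigr => l _; rewrite mulrA.
    under eq_bigr => l _ do rewrite -mulrA.
    by rewrite -mulr_sumr vg mulr0.
  have -> : a j = - (a i * \sum_l rho (mderiv l (f i)) * v l).
    by apply/eqP; rewrite -addr_eq0 addrC E1.
  have -> : rho (gamma j) = - (rho b * \sum_l rho (mderiv l (f i)) * v l).
    by apply/eqP; rewrite -addr_eq0 addrC E2.
  by ring.
(* By [aE], rho b times the relation equals a i times the differential of b f_i + c, that is a i h
   dg, whose component l0 has h dg nonzero. *)
have ai : a i = 0.
  have : a i * (rho h * rho (mderiv l0 g)) = 0.
    transitivity (rho b * \sum_j a j * rho (mderiv l0 (f j))); last by rewrite a0 mulr0.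
    rewrite -dW mulrDr !mulr_sumr (bigD1 i) //= gamma_i rmorph0 mul0r mulr0 add0r.
    rewrite [in RHS](bigD1 i) //=; congr (_ + _); first by ring.
    by apply: eq_bigr => j ji; rewrite !mulrA aE.
  by move/eqP; rewrite !mulf_eq0 (negPf h0) (negPf gl0) !orbF => /eqP.
move=> j; have [->//|ji] := eqVneq j i.
by apply: (mulfI b0); rewrite aE // ai mul0r mulr0.
Qed.

(** When no f_i depends on the others, a vector dual to f_i kills every other f_j and extracts the
    coefficient a i from the relation. *)
Lemma differentials_independent (a : 'I_m -> k) :
    (forall l, \sum_j a j * rho (mderiv l (f j)) = 0) ->
  forall j, a j = 0.
Proof.
move=> a0.
have [[i fi]|nf] := classic (exists i, fracs p rho (gens (fun h => h != i)) (rho (f i))).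
  exact: differentials_independent_dep fi a0.
move=> i; have nfi : ~ fracs p rho (gens (fun h => h != i)) (rho (f i)).
  by move=> fi; apply: nf; exists i.
have hS := gens_subring p f (fun h => h != i).
have BS b : B b -> gens (fun h => h != i) b by apply: gens_base.
have [v [v0 vi]] := separating_vector hp rho_frac hS BS nfi.
have : \sum_l (\sum_j a j * rho (mderiv l (f j))) * v l = 0.
  by apply: big1 => l _; rewrite a0 mul0r.
under eq_bigr => l _ do rewrite mulr_suml.
rewrite exchange_big (bigD1 i) //= [X in _ + X]big1 => [<-|j ji].
  rewrite addr0 -[LHS]mulr1 -vi mulr_sumr.
  by apply: eq_bigr => l _; rewrite mulrA.
transitivity (a j * \sum_l rho (mderiv l (f j)) * v l).
  by rewrite mulr_sumr; apply: eq_bigr => l _; rewrite mulrA.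
by rewrite v0 ?mulr0 //; apply/fracs_rho/gens_gen.
Qed.

End ModPrime.

End GcdToJacobian.

Theorem theorem4p4 (K : idomainType) (hK : is_ufd K) (p : nat)
  (hp : p \in [pchar K]) (n m : nat) (hm : (1 <= m <= n)%N)
  (f : 'I_m -> {mpoly K[n]}) :
  let cond1 := exists g : {mpoly K[n]}, is_dgcd f g /\ associated g 1 in
  let cond2 := exists d : {linear {mpoly K[n]} -> {mpoly K[n]}},
    is_derivation d /\ is_p_basis p (ppow_ring p) (constants d) f in
  let cond3 :=
    (forall (i : 'I_m) (b c : {mpoly K[n]}),
       R1 p f i b -> R1 p f i c -> b != 0 -> gcd_sim1 b c ->
       square_free (b * f i + c) /\ free_of (ppow_ring p) (b * f i + c))
    /\
    ((1 < m)%N ->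
     forall (i j : 'I_m), i != j ->
     forall b1 b2 c1 c2 : {mpoly K[n]},
       R2 p f i j b1 -> R2 p f i j b2 -> R2 p f i j c1 -> R2 p f i j c2 ->
       b1 != 0 -> b2 != 0 -> gcd_sim1 b1 c1 -> gcd_sim1 b2 c2 ->
       gcd_sim1 (b1 * f i + c1) (b2 * f j + c2)) in
  (cond1 <-> cond2) /\ (cond2 <-> cond3).
Proof.
move=> cond1 cond2 cond3.
have n0 : (0 < n)%N by case/andP: hm => m0; apply: leq_trans.
have fK := ufd_factorial hK; have fA := mpoly_factorial (n := n) fK.
have exA := mpoly_has_prime fK n0.
have c12 : cond1 -> cond2.
  move=> c1; apply: (jac1_p_basis hp fA n0 exA).
  by apply/(gcd1P fA exA); case: c1 => g; exists g.
have c23 : cond2 -> cond3.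
  case=> d [d_der d_basis]; split=> [i b c gb gc b0 bc|_ i j ij b1 b2 c1 c2].
    split; first exact: (p_basis_square_free hp fA exA d_der d_basis gb gc b0 bc).
    exact: (p_basis_free hp fA exA d_der d_basis gb gc b0 bc).
  move=> /R2_gens gb1 /R2_gens gb2 /R2_gens gc1 /R2_gens gc2.
  exact: (p_basis_coprime hp fA exA d_der d_basis ij gb1 gb2 gc1 gc2).
have c31 : cond3 -> cond1.
  case=> sqf cop; apply/(gcd1P fA exA) => g gP.
  have [k [rho [rho0 rho_frac]]] := prime_quotient_field gP.2.
  have [j gj] : exists j, ~ divides g (jac f j).
    apply: (divides_jac_minor rho0); apply: (differentials_independent hp fA exA gP rho0 rho_frac).
      exact: sqf.
    move=> i j ij b1 b2 c1 c2 S gb1 gb2 gc1 gc2.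
    apply: cop => //; try exact/R2_gens.
    rewrite -[m]card_ord; apply/card_gt1P; by exists i, j.
  by exists (jac f j) => //; exists j.
split; split=> //; first by move=> /c23/c31.
by move=> /c31/c12.
Qed.
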